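(* There exists a universal constant $c>0$ such that for any $n\ge1$ and any increasing continuously differentiable functions $f,g:\mathbb{R}^n\to[-1,1]$, $$\mathbb{E}_\mu[fg]-\mathbb{E}_\mu[f]\,\mathbb{E}_\mu[g]\ \ge\ c\sum_{i=1}^n\frac{\mathbb{E}_\mu[\partial_i f]\,\mathbb{E}_\mu[\partial_i g]}{\sqrt{\log(e/\mathbb{E}_\mu[\partial_i f])\,\log(e/\mathbb{E}_\mu[\partial_i g])}}.$$
   Context: $\mu$ is the standard Gaussian measure on $\mathbb{R}$ and $\mathbb{E}_\mu$ denotes integration with respect to the product measure $\mu^{\otimes n}$ on $\mathbb{R}^n$. A function on $\mathbb{R}^n$ is increasing if it is increasing (non-decreasing) in each coordinate. Convention: a summand in which $\mathbb{E}_\mu[\partial_i f]=0$ or $\mathbb{E}_\mu[\partial_i g]=0$ is interpreted as $0$. *)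

(* Defs.v *)
From HB Require Import structures.
From mathcomp Require Import all_boot all_order all_algebra.
From mathcomp Require Import all_classical all_reals all_analysis.
Set Implicit Arguments.
Unset Strict Implicit.
Unset Printing Implicit Defensive.
Import Order.TTheory GRing.Theory Num.Theory.
Import numFieldNormedType.Exports.
Local Open Scope classical_set_scope.
Local Open Scope ring_scope.

Section iterated_product.
Context d (T : measurableType d) (R : realType).

Definition tuple_cons n (x : T * n.-tuple T) : n.+1.-tuple T :=
  [tuple of x.1 :: x.2].

Lemma measurable_tuple_cons n : measurable_fun setT (@tuple_cons n).
Proof. exact: measurable_cons. Qed.

HB.instance Definition _ n :=
  isMeasurableFun.Build _ _ _ _ (@tuple_cons n) (@measurable_tuple_cons n).

(* The n-fold product measure on n.-tuple T, whose sigma-algebra is generated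
   by the coordinates: mathcomp-analysis only has binary products, so it is
   built as the image under tuple_cons of P \x (the n-fold product). *)
Fixpoint product_prob (P : probability T R) n : probability (n.-tuple T) R :=
  match n with
  | 0 => \d_([tuple] : 0.-tuple T)
  | n'.+1 => distribution (P \x product_prob P n')%E (@tuple_cons n')
  end.

Lemma measurable_box n (A : 'I_n -> set T) : (forall i, measurable (A i)) ->
  measurable [set t : n.-tuple T | forall i, A i (tnth t i)].
Proof.
move=> mA.
rewrite (_ : mkset _ = \bigcap_(i in [set: 'I_n]) (tnth (T:=T) ^~ i @^-1` A i)).
  apply: fin_bigcap_measurable => // i _.
  by rewrite -[X in measurable X]setTI; exact: measurable_tnth.
by apply/seteqP; split=> t /= h i => [_|]; exact: h.
Qed.

Lemma product_probE (P : probability T R) n (A : 'I_n -> set T) :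
  (forall i, measurable (A i)) ->
  product_prob P n [set t | forall i, A i (tnth t i)] = (\prod_(i < n) P (A i))%E.
Proof.
elim: n A => [|n IHn] A mA /=.
  by rewrite big_ord0 diracE mem_set //= => -[].
rewrite /distribution /pushforward big_ord_recl -IHn//.
rewrite (_ : _ @^-1` _ =
    A ord0 `*` [set t : n.-tuple T | forall i, A (lift ord0 i) (tnth t i)]).
  by apply: product_measure1E => //; exact: (measurable_box (A := fun i => A (lift ord0 i))).
apply/seteqP; split=> [[x t] /= h|[x t] /= [hx ht] i].
  by split=> [|i]; [exact: (h ord0)|have := h (lift ord0 i); rewrite tnthS].
by case: (unliftP ord0 i) => [j ->|->//]; rewrite tnthS.
Qed.

End iterated_product.

Section gaussian.
Context {R : realType}.
Implicit Types (n : nat).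

Definition std_gaussian n : probability (n.-tuple (measurableTypeR R)) R :=
  product_prob (normal_prob 0 1) n.

(* Topology and differentiation live on 'rV[R]_n, measurability on tuples:
   the function is integrated through the coordinate bijection. *)
Definition gaussE n (f : 'rV[R]_n -> R) : R :=
  \int[std_gaussian n]_t f (\row_i (tnth t i : R)).

Definition partial n (i : 'I_n) (f : 'rV[R]_n -> R) : 'rV[R]_n -> R :=
  'D_(delta_mx 0 i) f.

Definition continuously_differentiable n (f : 'rV[R]_n -> R) : Prop :=
  (forall x, differentiable f x) /\ (forall i, continuous (partial i f)).

Definition increasing n (f : 'rV[R]_n -> R) : Prop :=
  forall (i : 'I_n) (x : 'rV[R]_n) (h : R),
    0 <= h -> f x <= f (x + h *: delta_mx 0 i).

(* If a = 0 or b = 0, the convention of reading the summand as 0 is made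
   explicit; it agrees with the totalized quotient, whose numerator is 0. *)
Definition talagrand_term (a b : R) : R :=
  if (a == 0) || (b == 0) then 0
  else a * b / Num.sqrt (ln (expR 1 / a) * ln (expR 1 / b)).

End gaussian.

(* Main.v *)
Require Import Defs.
From HB Require Import structures.
From mathcomp Require Import all_boot all_order all_algebra.
From mathcomp Require Import all_classical all_reals all_analysis.
From mathcomp Require Import measurable_realfun.
From mathcomp Require Import ring lra.
Set Implicit Arguments.
Unset Strict Implicit.
Unset Printing Implicit Defensive.
Import Order.TTheory GRing.Theory Num.Theory.
Import numFieldNormedType.Exports.
Local Open Scope classical_set_scope.
Local Open Scope ring_scope.

(** The covariance is recovered from the noise correlation
    N(rho) = E [f(X) g(rho X + sqrt(1 - rho^2) Y)], with X, Y independent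
    standard Gaussian vectors: N(0) is the product of the means, and N(1) is
    E [f g]. So the covariance is the integral of N' over [0, 1], and the
    theorem holds because N' is nonnegative and stays large on a long enough
    initial interval.

    Formally N'(rho) is the sum over j of the correlations of d_j f and d_j g
    at level rho. Writing rho = r^2 s replaces the partial derivatives by
    their Ornstein-Uhlenbeck averages [ou_grad], which are bounded even when
    the derivatives are not ([is_derive_corr]). For increasing functions
    they are nonnegative, so N' >= 0 on [0, 1) ([corr_nondecreasing]), and
    they keep the mean of the derivative ([Rintegral_ou_grad]).

    For the quantitative part, fix a coordinate and let u, v be the two
    averaged derivatives, with means a and b; they take values in [0, 2].
    Their correlation M starts at M(0) = a b, and it cannot drop quickly: M'
    is again a sum of products of averaged gradients, and the squared length
    of such a gradient is bounded by the level-one inequality ([level1]),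
    which is of order m^2 log(e / m) where the function averages to m.
    Cauchy-Schwarz and a weighted arithmetic-geometric mean inequality turn
    this into the differential inequality M' >= - 4 S (M + a b), where S is
    the geometric mean of log(e / a) and log(e / b). Hence
    M(s) >= a b (1 - 8 S s) ([corr_lower_bound]), so the coordinate
    contributes at least a constant times a b / S to the covariance
    ([corr_increment]): the area of a triangle of height a b and base of
    order 1 / S.

    The derivative of the correlation comes from a first-order expansion of
    the Mehler kernel, the density of rho x + sqrt(1 - rho^2) Y against the
    Gaussian measure ([mehler_expansion]), transported from rho = 0 to an
    arbitrary rho by the semigroup identity [corr_add]; that identity, like
    the preservation of means, is an instance of the rotation invariance of
    the Gaussian measure, which follows from the symmetry of the kernel. *)

(** * Gaussian integrals on the line *)

Section gauss1.
Context {R : realType}.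
Notation mu := (@lebesgue_measure R).
Notation gam1 := (@normal_prob R 0 1).
Notation phi := (@normal_pdf R 0 1).
Implicit Types (h : measurableTypeR R -> \bar R).

Lemma integral_affine (a b : R) h : 0 < a ->
  measurable_fun setT h -> (forall x, 0 <= h x)%E ->
  (\int[mu]_x h (a * x + b)%R = a^-1%:E * \int[mu]_x h x)%E.
Proof.
move=> a0 mh h0.
pose aff0 : measurableTypeR R -> measurableTypeR R := fun x => a * x + b.
have maff : measurable_fun setT aff0.
  by apply: measurable_funD => //; exact: measurable_funM.
pose pm : {measure set (measurableTypeR R) -> \bar R} :=
  measure_function_pushforward__canonical__measure_function_Measure mu maff.
have aP : 0 <= a by exact: ltW.
pose nna : {nonneg R} := NngNum aP.
have muE A : measurable A -> mu A = mscale nna (pm) A.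
  apply: lebesgue_measure_unique => /= _ [[c d]] _ <-.
  rewrite /mscale/=.
  have -> : pm `]c, d]%classic =
      mu `](c - b) / a, (d - b) / a]%classic.
    congr (mu _); apply/seteqP; split => x /=; rewrite !in_itv/= /aff0;
      by rewrite ltr_pdivrMr// ler_pdivlMr// ltrBlDr lerBrDr mulrC.
  rewrite !lebesgue_measure_itv/= !lte_fin ltr_pM2r ?invr_gt0// ltrD2r.
  case: ifPn => cd; last by rewrite mule0.
  by rewrite -!EFinB -EFinM; congr EFin; field; rewrite gt_eqF.
rewrite [in RHS](eq_measure_integral (mscale nna pm)); last first.
  by move=> A mA _; exact: muE.
rewrite ge0_integral_mscale//=.
rewrite ge0_integral_pushforward//=.
by rewrite muleA -EFinM mulVf ?gt_eqF// mul1e.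
Qed.

(** The normal law is only known to be dominated by the Lebesgue measure; its
    Radon-Nikodym derivative is identified with the density almost
    everywhere. *)
Lemma integral_gauss1 h : measurable_fun setT h -> (forall x, 0 <= h x)%E ->
  (\int[gam1]_x h x = \int[mu]_x (h x * (phi x)%:E))%E.
Proof.
move=> mh h0.
have dom : gam1 `<< mu := normal_prob_dominates 0 1.
rewrite -(Radon_Nikodym_SigmaFinite.change_of_variables dom)//.
have iRN := Radon_Nikodym_SigmaFinite.f_integrable dom.
have mphi : measurable_fun setT (fun x : measurableTypeR R => (phi x)%:E).
  by apply/measurable_EFinP; exact: measurable_normal_pdf.
apply: ae_eq_integral => //.
- apply: emeasurable_funM => //; exact: (measurable_int mu).
- exact: emeasurable_funM.
- apply: ae_eqe_mul2l => /=.
  apply: integral_ae_eq => //=.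
  by move=> E E01 mE; rewrite -Radon_Nikodym_SigmaFinite.f_integral.
Qed.

End gauss1.

Section gauss1_moments.
Context {R : realType}.
Notation mu := (@lebesgue_measure R).
Notation phi := (@normal_pdf R 0 1).

Lemma stdnormal_pdfE x : phi x = normal_peak 1 * expR (- (x ^+ 2 / 2)).
Proof.
by rewrite normal_pdfE ?oner_eq0// /normal_fun subr0 expr1n mulNr.
Qed.

Lemma continuous_stdnormal_pdf : continuous phi.
Proof. by apply: continuous_normal_pdf; rewrite oner_eq0. Qed.

Lemma is_derive_stdnormal_pdf (x : R) : is_derive x 1 phi (- (x * phi x)).
Proof.
rewrite stdnormal_pdfE (_ : phi = normal_peak 1 \*: (expR \o (fun x : R => - (x ^+ 2 / 2)))); last first.
  by apply/funext => y; rewrite stdnormal_pdfE.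
have d1 : is_derive x 1 (fun x : R => - (x ^+ 2 / 2)) (- x).
  by apply: is_derive_eq; rewrite /GRing.scale /=; field.
have d2 := @is_derive1_comp _ expR (fun x : R => - (x ^+ 2 / 2)) x _ _
  (is_derive_expR (- (x ^+ 2 / 2))) d1.
apply: is_derive_eq; rewrite /GRing.scale /=; ring.
Qed.

Lemma cvgy_stdnormal_pdf : phi x @[x --> +oo] --> (0 : R).
Proof.
apply: (@squeeze_cvgr _ _ _ _ (cst 0) (fun x => normal_peak 1 * expR (- x))).
- near=> x; rewrite normal_pdf_ge0/= stdnormal_pdfE ler_wpM2l ?normal_peak_ge0//.
  rewrite ler_expR lerN2.
  have x2 : 2 <= x by near: x; apply: nbhs_pinfty_ge; rewrite num_real.
  nra.
- exact: cvg_cst.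
- rewrite -(mulr0 (normal_peak 1)); apply: cvgMr; exact: cvgr_expR.
Unshelve. all: by end_near. Qed.

Lemma ge0_integral_fold (h : measurableTypeR R -> \bar R) :
  measurable_fun setT h -> (forall x, 0 <= h x)%E ->
  (\int[mu]_x h x = \int[mu]_(x in `[0%R, +oo[) h x +
                    \int[mu]_(x in `[0%R, +oo[) h (- x)%R)%E.
Proof.
move=> mh h0.
rewrite -(@setUv _ `]-oo, 0%R[%classic) ge0_integral_setU//=; last 3 first.
- exact: measurableC.
- by rewrite setUv.
- exact/disj_setPCl.
rewrite addeC setCitvl; congr (_ + _)%E.
rewrite integral_itv_bndo_bndc; last exact: measurable_funTS.
rewrite (@ge0_integration_by_substitution0 _ (fun x => h (- x)%R))//.
- by apply: eq_integral => x _; rewrite opprK.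
- by apply: measurableT_comp => //; exact: measurable_oppr.
Qed.

(** The primitive of h' phi + x (C - h) phi is (h - C) phi, which vanishes at
    infinity. Comparing h with its bound C makes both integrands nonnegative on the
    half-line, so the identity holds in the extended reals before h' is known
    to be integrable. *)
Lemma stein_half (h h' : R -> R) (C : R) :
  (forall x : R, is_derive x 1 h (h' x)) -> continuous h' ->
  (forall x, 0 <= h' x) -> (forall x, `|h x| <= C) ->
  (\int[mu]_(x in `[0%R, +oo[) (h' x * phi x)%:E +
   \int[mu]_(x in `[0%R, +oo[) (x * (C - h x) * phi x)%:E =
   ((C - h 0) * phi 0)%:E)%E.
Proof.
move=> dh ch' h'0 hC.
have ch : continuous h.
  move=> x; apply: differentiable_continuous; apply/derivable1_diffP.
  exact: (@ex_derive _ _ _ _ _ _ _ (dh x)).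
have Ch x : 0 <= C - h x by rewrite subr_ge0 (le_trans (ler_norm _)).
have cf1 : continuous (fun x : R => h' x * phi x).
  by move=> x; apply: cvgM; [exact: ch'|exact: continuous_stdnormal_pdf].
have cf2 : continuous (fun x : R => x * (C - h x) * phi x).
  move=> x; apply: cvgM; last exact: continuous_stdnormal_pdf.
  by apply: cvgM; [exact: cvg_id|apply: cvgB; [exact: cvg_cst|exact: ch]].
rewrite -ge0_integralD//=; last 4 first.
- by move=> x _; rewrite lee_fin mulr_ge0// normal_pdf_ge0.
- apply/measurable_EFinP/measurable_funTS; exact: continuous_measurable_fun.
- move=> x; rewrite in_itv/= andbT => x0.
  by rewrite lee_fin !mulr_ge0// normal_pdf_ge0.
- apply/measurable_EFinP/measurable_funTS; exact: continuous_measurable_fun.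
have dF (x : R) : is_derive x 1 (fun x => (h x - C) * phi x)
    (h' x * phi x + x * (C - h x) * phi x).
  have dhx := dh x; have dp := is_derive_stdnormal_pdf x.
  apply: is_derive_eq; rewrite /GRing.scale /=; ring.
under eq_integral do rewrite -EFinD.
rewrite (@ge0_continuous_FTC2y _
  (fun x : R => h' x * phi x + x * (C - h x) * phi x) (fun x : R => (h x - C) * phi x) 0 0).
- by rewrite -EFinB sub0r -mulNr opprB.
- by move=> x x0; rewrite addr_ge0 ?mulr_ge0 ?normal_pdf_ge0.
- apply: continuous_subspaceT => x. by apply: cvgD; [exact: cf1|exact: cf2].
- apply: (@squeeze_cvgr _ _ _ _ (fun x => - (2 * C) * phi x) (cst 0)).
  + near=> x; have := hC x; rewrite ler_norml => /andP[h1 h2].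
    have := normal_pdf_ge0 0 1 x => p0; apply/andP; split => /=; nra.
  + rewrite -[X in _ --> X](mulr0 (- (2 * C))); apply: cvgMr; exact: cvgy_stdnormal_pdf.
  + exact: cvg_cst.
- by move=> x _; exact: (@ex_derive _ _ _ _ _ _ _ (dF x)).
- apply: cvg_at_right_filter; apply: cvgM; last exact: continuous_stdnormal_pdf.
  by apply: cvgB; [exact: ch|exact: cvg_cst].
- by move=> x _; rewrite derive1E (@derive_val _ _ _ _ _ _ _ (dF x)).
Unshelve. all: by end_near. Qed.

End gauss1_moments.

Section gauss1_stein_formula.
Context {R : realType}.
Notation mu := (@lebesgue_measure R).
Notation gam1 := (@normal_prob R 0 1).
Notation phi := (@normal_pdf R 0 1).

Lemma stdnormal_pdfN x : phi (- x) = phi x.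
Proof. by rewrite !stdnormal_pdfE sqrrN. Qed.

(** Stein's identity E h'(X) = E (X h(X)), with 2 C phi(0) = C E |X| added on
    both sides so that both integrals are of nonnegative functions: the
    integrability of h' is then a conclusion. *)
Lemma stein_sum (h h' : R -> R) (C : R) :
  (forall x : R, is_derive x 1 h (h' x)) -> continuous h' ->
  (forall x, 0 <= h' x) -> (forall x, `|h x| <= C) ->
  (\int[gam1]_x (h' x)%:E + \int[gam1]_x (C * `|x| - x * h x)%:E =
   (2 * C * phi 0)%:E)%E.
Proof.
move=> dh ch' h'0 hC.
have ch : continuous h.
  move=> x; apply: differentiable_continuous; apply/derivable1_diffP.
  exact: (@ex_derive _ _ _ _ _ _ _ (dh x)).
have hb x : - C <= h x <= C by rewrite -ler_norml.
have xh0 (x : R) : 0 <= C * `|x| - x * h x.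
  have [x0|x0] := lerP 0 x.
    by rewrite ger0_norm//; have /andP[_ ?] := hb x; nra.
  by rewrite ltr0_norm//; have /andP[? _] := hb x; nra.
have mphi : measurable_fun setT (fun x : measurableTypeR R => (phi x)%:E).
  by apply/measurable_EFinP; exact: measurable_normal_pdf.
have mh' : measurable_fun setT (fun x : measurableTypeR R => (h' x)%:E).
  by apply/measurable_EFinP; exact: continuous_measurable_fun.
have mxh : measurable_fun setT
    (fun x : measurableTypeR R => (C * `|x| - x * h x)%:E).
  apply/measurable_EFinP; apply: continuous_measurable_fun => x.
  apply: cvgB; last by apply: cvgM; [exact: cvg_id|exact: ch].
  by apply: cvgM; [exact: cvg_cst|exact: norm_continuous].
rewrite !integral_gauss1//.
rewrite (@ge0_integral_fold _ (fun x => (h' x)%:E * (phi x)%:E)%E); last 2 first.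
- exact: emeasurable_funM.
- by move=> x; rewrite -EFinM lee_fin mulr_ge0// normal_pdf_ge0.
rewrite (@ge0_integral_fold _
  (fun x => (C * `|x| - x * h x)%:E * (phi x)%:E)%E); last 2 first.
- exact: emeasurable_funM.
- by move=> x; rewrite -EFinM lee_fin mulr_ge0// normal_pdf_ge0.
have H1 := stein_half dh ch' h'0 hC.
pose g x := - h (- x).
have dg (x : R) : is_derive x 1 g (h' (- x)).
  have d1 : is_derive x 1 (fun x : R => - x) (-1).
    by apply: is_derive_eq.
  have d2 := @is_derive1_comp _ h (fun x : R => - x) x _ _ (dh (- x)) d1.
  have -> : g = - (h \o (fun x : R => - x)) by apply/funext.
  by apply: is_derive_eq; rewrite mulrN1 opprK.
have cg' : continuous (fun x => h' (- x)).
  by move=> x; apply: continuous_comp; [exact: opp_continuous|exact: ch'].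
have H2 := stein_half dg cg' (fun x => h'0 (- x))
  (fun x => eq_ind_r (fun y => y <= C) (hC (- x)) (normrN _)).
rewrite addeACA.
have -> : (2 * C * phi 0)%:E = ((C - h 0) * phi 0)%:E + ((C - g 0) * phi 0)%:E :> \bar R.
  by rewrite /g oppr0 -EFinD; congr EFin; ring.
rewrite -H1 -H2.
have E1 : (\int[mu]_(x in `[0%R, +oo[) ((C * `|x| - x * h x)%:E * (phi x)%:E) =
    \int[mu]_(x in `[0%R, +oo[) (x * (C - h x) * phi x)%:E)%E.
  apply: eq_integral => x; rewrite inE/= in_itv/= andbT => x0.
  by rewrite -EFinM ger0_norm//; congr (_ * _)%:E; ring.
have E2 : (\int[mu]_(x in `[0%R, +oo[)
      ((C * `|- x| - (- x) * h (- x))%:E * (phi (- x))%:E) =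
    \int[mu]_(x in `[0%R, +oo[) (x * (C - g x) * phi x)%:E)%E.
  apply: eq_integral => x; rewrite inE/= in_itv/= andbT => x0.
  rewrite -EFinM stdnormal_pdfN normrN ger0_norm//.
  by congr (_ * _)%:E; rewrite /g; ring.
have E3 : (\int[mu]_(x in `[0%R, +oo[) ((h' (- x))%:E * (phi (- x))%:E) =
    \int[mu]_(x in `[0%R, +oo[) (h' (- x) * phi x)%:E)%E.
  by apply: eq_integral => x _; rewrite -EFinM stdnormal_pdfN.
by rewrite E1 E2 E3.
Qed.

Lemma gauss1_abs_moment : (\int[gam1]_x (`|x|)%:E = (2 * phi 0)%:E)%E.
Proof.
have := @stein_sum (cst 0) (cst 0) 1.
rewrite /cst integral0 add0e mulr1 => <-.
- by apply: eq_integral => x _; rewrite mul1r mulr0 subr0.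
- by move=> x; exact: cvg_cst.
- by [].
- by move=> x; rewrite normr0.
Qed.

Lemma gauss1_abs_le1 : (\int[gam1]_x (`|x|)%:E <= 1)%E.
Proof.
rewrite gauss1_abs_moment lee_fin stdnormal_pdfE expr0n mul0r oppr0 expR0 mulr1.
have p2 : 2 * 2 <= (1 : R) ^+ 2 * pi *+ 2.
  by rewrite expr1n mul1r -[leRHS]mulr_natl ler_pM2l ?pi_ge2.
rewrite /normal_peak ler_pdivrMr ?sqrtr_gt0 ?(lt_le_trans _ p2) ?mulr_gt0// mul1r.
by rewrite -(@ger0_norm _ 2)// -sqrtr_sqr expr2 ler_wsqrtr.
Qed.

End gauss1_stein_formula.

(** * The Mehler kernel on the line *)

(** The weight that completes t to a unit vector: t x + cosine t w is standard
    Gaussian when x and w are independent and standard Gaussian. *)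
Definition cosine {R : realType} (t : R) : R := Num.sqrt (1 - t ^+ 2).

(** The density of t x + cosine t W, W standard Gaussian, with respect to the
    standard Gaussian measure. *)
Definition mehler1 {R : realType} (t x y : R) : R :=
  (cosine t)^-1 *
  expR ((2 * t * (x * y) - t ^+ 2 * (x ^+ 2 + y ^+ 2)) / (2 * (1 - t ^+ 2))).

Section gauss1_mehler.
Context {R : realType}.
Notation mu := (@lebesgue_measure R).
Notation gam1 := (@normal_prob R 0 1).
Notation phi := (@normal_pdf R 0 1).
Implicit Types (t x y : R).

Lemma sqr_lt1 t : -1 < t < 1 -> 0 < 1 - t ^+ 2.
Proof. by move=> /andP[t1 t2]; nra. Qed.

Lemma cosine_gt0 t : -1 < t < 1 -> 0 < cosine t.
Proof. by move=> t1; rewrite sqrtr_gt0 sqr_lt1. Qed.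

Lemma sqr_cosine t : -1 < t < 1 -> cosine t ^+ 2 = 1 - t ^+ 2.
Proof. by move=> t1; rewrite sqr_sqrtr// ltW// sqr_lt1. Qed.

Lemma mehler1C t x y : mehler1 t x y = mehler1 t y x.
Proof. by rewrite /mehler1 (mulrC x) (addrC (x ^+ 2)). Qed.

Lemma mehler1_ge0 t x y : 0 <= mehler1 t x y.
Proof. by rewrite mulr_ge0 ?expR_ge0// invr_ge0 sqrtr_ge0. Qed.

Lemma mehler1_pdf t x y : -1 < t < 1 ->
  mehler1 t x y * phi y = (cosine t)^-1 * phi ((y - t * x) / cosine t).
Proof.
move=> t1; rewrite !stdnormal_pdfE /mehler1.
rewrite mulrACA -expRD [RHS]mulrA; congr (_ * expR _).
rewrite expr_div_n sqr_cosine//.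
by field; rewrite ?gt_eqF ?sqr_lt1.
Qed.

Lemma gauss1_mehler t x (h : measurableTypeR R -> \bar R) : -1 < t < 1 ->
  measurable_fun setT h -> (forall x, 0 <= h x)%E ->
  (\int[gam1]_w h (t * x + cosine t * w)%R =
   \int[gam1]_y (h y * (mehler1 t x y)%:E))%E.
Proof.
move=> t1 mh h0; have c0 := cosine_gt0 t1.
have mphi : measurable_fun setT (fun x : measurableTypeR R => (phi x)%:E).
  by apply/measurable_EFinP; exact: measurable_normal_pdf.
have maff (a b : R) : measurable_fun setT
    (fun x : measurableTypeR R => a * x + b : measurableTypeR R).
  by apply: measurable_funD => //; exact: measurable_funM.
have mk : measurable_fun setT
    (fun y : measurableTypeR R => (mehler1 t x y)%:E).
  apply/measurable_EFinP; apply: measurable_funM => //.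
  apply: measurableT_comp => //; apply: measurable_funM => //.
  apply: measurable_funB; first by do 2 apply: measurable_funM => //.
  apply: measurable_funM => //; apply: measurable_funD => //.
have mc : measurable_fun setT
    (fun w : measurableTypeR R => h (t * x + cosine t * w)%R).
  by under eq_fun do rewrite addrC; exact: (measurableT_comp mh (maff _ _)).
rewrite integral_gauss1// [RHS]integral_gauss1; last 2 first.
- exact: emeasurable_funM.
- by move=> y; rewrite mule_ge0// lee_fin mehler1_ge0.
pose G y := (h y * (phi ((y - t * x) / cosine t))%:E)%E.
transitivity (\int[mu]_w G (cosine t * w + t * x)%R)%E.
  apply: eq_integral => w _; rewrite /G addrC; congr (_ * (phi _)%:E)%E.
  by rewrite addrK mulrC mulKf// gt_eqF.
have mG : measurable_fun setT G.
  apply: emeasurable_funM => //.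
  have := measurableT_comp mphi (maff (cosine t)^-1 (- (t * x) / cosine t)).
  apply: eq_measurable_fun => y _ /=; congr (phi _)%:E.
  by rewrite mulrBl mulrC mulNr.
have G0 y : (0 <= G y)%E by rewrite mule_ge0// lee_fin normal_pdf_ge0.
rewrite integral_affine// -ge0_integralZl//; last first.
  by rewrite lee_fin invr_ge0 ltW.
apply: eq_integral => y _; rewrite /G -muleA -EFinM mehler1_pdf//.
by rewrite EFinM muleCA.
Qed.

(** Tilting the standard density by an exponential gives the density of the
    shifted normal law. *)
Lemma gauss1_mgf (l : R) :
  (\int[gam1]_x (expR (l * x))%:E = (expR (l ^+ 2 / 2))%:E)%E.
Proof.
have m1 : measurable_fun setT (fun x : measurableTypeR R => (expR (l * x))%:E).
  apply/measurable_EFinP; apply: measurableT_comp => //.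
rewrite integral_gauss1//.
transitivity (\int[mu]_x ((expR (l ^+ 2 / 2))%:E * (normal_pdf l 1 x)%:E))%E.
  apply: eq_integral => x _; rewrite -!EFinM; congr EFin.
  rewrite stdnormal_pdfE normal_pdfE ?oner_eq0// mulrCA [RHS]mulrCA.
  congr (_ * _); rewrite -!expRD; congr expR.
  by rewrite expr1n; field.
rewrite ge0_integralZl//.
- by rewrite integral_normal_pdf mule1.
- by apply/measurable_EFinP; exact: measurable_normal_pdf.
- by move=> x _; rewrite lee_fin normal_pdf_ge0.
Qed.

(** The exponent 3/8 is the one that the expansion of the Mehler kernel
    produces; any exponent below 1/2 is integrable, and 3/8 leaves the density
    of variance 4. *)
Lemma gauss1_sqr_exp_lty :
  (\int[gam1]_x (expR (3 / 8 * x ^+ 2))%:E < +oo)%E.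
Proof.
have m1 : measurable_fun setT
    (fun x : measurableTypeR R => (expR (3 / 8 * x ^+ 2))%:E).
  apply/measurable_EFinP; apply: measurableT_comp => //.
  by apply: measurable_funM.
rewrite integral_gauss1//.
have p0 : normal_peak (2 : R) != 0 by rewrite gt_eqF// normal_peak_gt0.
under eq_integral => x _.
  have -> : ((expR (3 / 8 * x ^+ 2))%:E * (phi x)%:E =
      (normal_peak 1 / normal_peak 2)%:E * (normal_pdf 0 2 x)%:E)%E.
    rewrite -!EFinM; congr EFin.
    rewrite stdnormal_pdfE normal_pdfE// [RHS]mulrA divfK// mulrCA.
    congr (_ * _); rewrite -expRD; congr expR.
    by rewrite subr0; field.
  over.
rewrite ge0_integralZl//.
- by rewrite integral_normal_pdf mule1 ltry.
- by apply/measurable_EFinP; exact: measurable_normal_pdf.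
- by move=> x _; rewrite lee_fin normal_pdf_ge0.
- by rewrite lee_fin divr_ge0 ?normal_peak_ge0.
Qed.

End gauss1_mehler.

(** * Gaussian integrals on tuples *)

Section gauss_tuples.
Context {R : realType}.
Notation V n := (n.-tuple (measurableTypeR R)).
Notation gam1 := (@normal_prob R 0 1).
Notation gam := (@std_gaussian R).
Implicit Types (n : nat).

Definition lin n (a : R) (x : V n) (b : R) (y : V n) : V n :=
  [tuple a * tnth x i + b * tnth y i | i < n].

Definition upd n (x : V n) (i : 'I_n) (u : R) : V n :=
  [tuple if j == i then u else tnth x j | j < n].

Definition mehler n (t : R) (x y : V n) : R :=
  \prod_(i < n) mehler1 t (tnth x i) (tnth y i).

Lemma measurable_tnth_comp d (S : measurableType d) n (F : S -> V n) i :
  measurable_fun setT F -> measurable_fun setT (fun p => tnth (F p) i).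
Proof. by move=> mF; exact: (measurableT_comp (measurable_tnth i)). Qed.

Lemma measurable_lin d (S : measurableType d) n (F G : S -> V n) a b :
  measurable_fun setT F -> measurable_fun setT G ->
  measurable_fun setT (fun p => lin a (F p) b (G p)).
Proof.
move=> mF mG; apply/measurable_fun_tnthP => i.
rewrite (_ : _ \o _ = fun p => a * tnth (F p) i + b * tnth (G p) i); last first.
  by apply/funext => p /=; rewrite tnth_mktuple.
by apply: measurable_funD; apply: measurable_funM => //; exact: measurable_tnth_comp.
Qed.

Lemma measurable_upd d (S : measurableType d) n (F : S -> V n) i (G : S -> measurableTypeR R) :
  measurable_fun setT F -> measurable_fun setT G ->
  measurable_fun setT (fun p => upd (F p) i (G p)).
Proof.
move=> mF mG; apply/measurable_fun_tnthP => j.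
rewrite (_ : _ \o _ = fun p => if j == i then G p else tnth (F p) j); last first.
  by apply/funext => p /=; rewrite tnth_mktuple.
by case: (j == i) => //; exact: measurable_tnth_comp.
Qed.

Lemma measurable_mehler1 d (S : measurableType d) t (F G : S -> measurableTypeR R) :
  measurable_fun setT F -> measurable_fun setT G ->
  measurable_fun setT (fun p => mehler1 t (F p) (G p)).
Proof.
move=> mF mG; apply: measurable_funM => //.
apply: measurableT_comp => //; apply: measurable_funM => //.
apply: measurable_funB; first by do 2 apply: measurable_funM => //.
apply: measurable_funM => //; apply: measurable_funD; exact: measurable_funX.
Qed.

Lemma measurable_mehler d (S : measurableType d) n t (F G : S -> V n) :
  measurable_fun setT F -> measurable_fun setT G ->
  measurable_fun setT (fun p => mehler t (F p) (G p)).
Proof.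
move=> mF mG; apply: measurable_prod => i _.
by apply: measurable_mehler1; exact: measurable_tnth_comp.
Qed.

Lemma integral_gauss_cons n (h : V n.+1 -> \bar R) :
  measurable_fun setT h -> (forall x, 0 <= h x)%E ->
  (\int[gam n.+1]_x h x =
   \int[gam1]_x \int[gam n]_y h (@tuple_cons _ _ n (x, y)))%E.
Proof.
move=> mh h0; rewrite ge0_integral_distribution// fubini_tonelli1//.
  exact: measurableT_comp.
by move=> x; exact: h0.
Qed.

Lemma measurable_tuple_cons_comp d (S : measurableType d) n
    (F : S -> measurableTypeR R) (G : S -> V n) :
  measurable_fun setT F -> measurable_fun setT G ->
  measurable_fun setT (fun p => @tuple_cons _ _ n (F p, G p)).
Proof. by move=> mF mG; exact: measurable_cons. Qed.

Lemma integral_gauss_prod n (h : 'I_n -> R -> R) :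
  (forall i, measurable_fun setT (h i : measurableTypeR R -> R)) ->
  (forall i x, 0 <= h i x) ->
  (\int[gam n]_x (\prod_(i < n) h i (tnth x i))%:E =
   \prod_(i < n) \int[gam1]_x (h i x)%:E)%E.
Proof.
elim: n h => [|n IH] h mh h0.
  rewrite big_ord0; under eq_integral do rewrite big_ord0.
  by rewrite integral_cst//= mul1e probability_setT.
rewrite integral_gauss_cons; first last.
- by move=> x; rewrite lee_fin prodr_ge0.
- apply/measurable_EFinP; apply: measurable_prod => i _.
  exact: (measurableT_comp (mh i) (measurable_tnth i)).
rewrite big_ord_recl -IH//.
have mp : measurable_fun setT
    (fun y : V n => (\prod_(i < n) h (lift ord0 i) (tnth y i))%:E).
  apply/measurable_EFinP; apply: measurable_prod => i _.
  exact: (measurableT_comp (mh _) (measurable_tnth i)).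
rewrite -ge0_integralZr//; last 3 first.
- exact/measurable_EFinP.
- by move=> x _; rewrite lee_fin.
- by apply: integral_ge0 => y _; rewrite lee_fin prodr_ge0.
apply: eq_integral => x _; rewrite -ge0_integralZl//; last 2 first.
- by move=> y _; rewrite lee_fin prodr_ge0.
- by rewrite lee_fin.
apply: eq_integral => y _; rewrite big_ord_recl EFinM; congr (_ * _%:E)%E.
by apply: eq_bigr => i _; rewrite tnthS.
Qed.

Lemma lin_cons n a b (x y : R) (u v : V n) :
  lin a (@tuple_cons _ _ n (x, u)) b (@tuple_cons _ _ n (y, v)) =
  @tuple_cons _ _ n (a * x + b * y, lin a u b v).
Proof.
apply: eq_from_tnth => i; rewrite tnth_mktuple.
by case: (unliftP ord0 i) => [j ->|->//]; rewrite !tnthS tnth_mktuple.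
Qed.

Lemma upd0_cons n x y (u : V n) :
  upd (@tuple_cons _ _ n (x, u)) ord0 y = @tuple_cons _ _ n (y, u).
Proof.
apply: eq_from_tnth => i; rewrite tnth_mktuple.
by case: (unliftP ord0 i) => [j ->|->//]; rewrite !tnthS.
Qed.

Lemma updS_cons n x y (u : V n) i :
  upd (@tuple_cons _ _ n (x, u)) (lift ord0 i) y =
  @tuple_cons _ _ n (x, upd u i y).
Proof.
apply: eq_from_tnth => j; rewrite tnth_mktuple.
case: (unliftP ord0 j) => [k ->|->//]; rewrite !tnthS tnth_mktuple.
by rewrite (inj_eq lift_inj).
Qed.

Lemma mehler_cons n t (x y : R) (u v : V n) :
  mehler t (@tuple_cons _ _ n (x, u)) (@tuple_cons _ _ n (y, v)) =
  mehler1 t x y * mehler t u v.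
Proof.
rewrite /mehler big_ord_recl; congr (_ * _).
by apply: eq_bigr => i _; rewrite !tnthS.
Qed.

Lemma mehler_ge0 n t (x y : V n) : 0 <= mehler t x y.
Proof. by apply: prodr_ge0 => i _; exact: mehler1_ge0. Qed.

Lemma mehlerC n t (x y : V n) : mehler t x y = mehler t y x.
Proof. by apply: eq_bigr => i _; rewrite mehler1C. Qed.

Lemma cons_eta n (x : V n.+1) : exists a u, x = @tuple_cons _ _ n (a, u).
Proof. by exists (thead x), [tuple of behead x]; exact: tuple_eta. Qed.

Lemma integral_gauss_mehler n t (x : V n) (h : V n -> \bar R) : -1 < t < 1 ->
  measurable_fun setT h -> (forall x, 0 <= h x)%E ->
  (\int[gam n]_w h (lin t x (cosine t) w) =
   \int[gam n]_y (h y * (mehler t x y)%:E))%E.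
Proof.
move=> t1; elim: n x h => [|n IH] x h mh h0.
  apply: eq_integral => y _; rewrite /mehler big_ord0 mule1.
  by congr h; apply: eq_from_tnth => -[].
have [a [u ->]] := cons_eta x.
have mk (S : V n.+1) : measurable_fun setT (fun y : V n.+1 => (mehler t S y)%:E).
  by apply/measurable_EFinP; apply: measurable_mehler.
rewrite [RHS]integral_gauss_cons; last 2 first.
- exact: emeasurable_funM.
- by move=> y; rewrite mule_ge0// lee_fin mehler_ge0.
have ml : measurable_fun setT
    (fun w => h (lin t (@tuple_cons _ _ n (a, u)) (cosine t) w)).
  by apply: (measurableT_comp mh); exact: measurable_lin.
rewrite (integral_gauss_cons ml (fun w => h0 _)).
pose H v := (\int[gam n]_y (h (@tuple_cons _ _ n (v, y)) * (mehler t u y)%:E))%E.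
have mhk : measurable_fun setT (fun p : measurableTypeR R * V n =>
    (h (@tuple_cons _ _ n p) * (mehler t u p.2)%:E)%E).
  apply: emeasurable_funM; first exact: measurableT_comp.
  by apply/measurable_EFinP; exact: measurable_mehler.
transitivity (\int[gam1]_w H (t * a + cosine t * w)%R)%E.
  apply: eq_integral => w _; rewrite /H -IH//.
  - by apply: eq_integral => y _; rewrite lin_cons.
  - apply: (measurableT_comp mh); exact: measurable_tuple_cons_comp.
rewrite gauss1_mehler//; last 2 first.
- apply: (measurable_fun_fubini_tonelli_F _ mhk) => p.
  by rewrite mule_ge0// lee_fin mehler_ge0.
- by move=> v; apply: integral_ge0 => y _; rewrite mule_ge0// lee_fin mehler_ge0.
apply: eq_integral => v _; rewrite -ge0_integralZr//; last 3 first.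
- apply: emeasurable_funM.
    by apply: (measurableT_comp mh); exact: measurable_tuple_cons_comp.
  by apply/measurable_EFinP; exact: measurable_mehler.
- by move=> y _; rewrite mule_ge0// lee_fin mehler_ge0.
- by rewrite lee_fin mehler1_ge0.
apply: eq_integral => y _; rewrite mehler_cons EFinM.
by rewrite -muleA; congr (_ * _)%E; rewrite muleC.
Qed.

(** Redrawing one coordinate does not change a Gaussian integral. This is the
    form in which Fubini isolates an arbitrary coordinate. *)
Lemma integral_gauss_resample n (i : 'I_n) (h : V n -> \bar R) :
  measurable_fun setT h -> (forall x, 0 <= h x)%E ->
  (\int[gam n]_x h x = \int[gam n]_x \int[gam1]_u h (upd x i u))%E.
Proof.
elim: n i h => [[]//|n IH] i h mh h0.
have mu' : measurable_fun setT (fun p : V n.+1 * measurableTypeR R =>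
    h (upd p.1 i p.2)).
  by apply: (measurableT_comp mh); exact: measurable_upd.
rewrite [RHS]integral_gauss_cons; last 2 first.
- by apply: (measurable_fun_fubini_tonelli_F _ mu') => p; exact: h0.
- by move=> x; apply: integral_ge0 => u _; exact: h0.
rewrite (integral_gauss_cons mh h0).
case: (unliftP ord0 i) => [j|] ->.
  apply: eq_integral => x _.
  have mhx : measurable_fun setT (fun y : V n => h (@tuple_cons _ _ n (x, y))).
    by apply: (measurableT_comp mh); exact: measurable_tuple_cons_comp.
  rewrite (IH j _ mhx (fun y => h0 _)).
  by apply: eq_integral => y _; apply: eq_integral => u _; rewrite updS_cons.
under [RHS]eq_integral => x _.
  under eq_integral => y _ do under eq_integral => u _ do rewrite upd0_cons.
  over.
rewrite integral_cst//= probability_setT mule1.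
rewrite (fubini_tonelli (fun p : measurableTypeR R * V n =>
  h (@tuple_cons _ _ n p)))//.
exact: measurableT_comp.
Qed.

End gauss_tuples.

(** * Rotation invariance and correlated pairs *)

Section rotation.
Context {R : realType}.
Notation V n := (n.-tuple (measurableTypeR R)).
Notation gam := (@std_gaussian R).
Implicit Types (n : nat).

Lemma measurable_integral_snd d (S : measurableType d) n (f : S * V n -> \bar R) :
  measurable_fun setT f -> (forall p, 0 <= f p)%E ->
  measurable_fun setT (fun x => \int[gam n]_y f (x, y))%E.
Proof. by move=> mf f0; exact: (measurable_fun_fubini_tonelli_F _ mf). Qed.

Lemma integral_gaussC n (f : V n * V n -> \bar R) :
  measurable_fun setT f -> (forall p, 0 <= f p)%E ->
  (\int[gam n]_x \int[gam n]_y f (x, y) =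
   \int[gam n]_y \int[gam n]_x f (x, y))%E.
Proof. by move=> mf f0; exact: fubini_tonelli. Qed.

(** The pair (x, t x + cosine t y) is exchangeable because its density, the
    Mehler kernel, is symmetric. *)
Lemma integral_gauss_corrC n t (h : V n * V n -> \bar R) : -1 < t < 1 ->
  measurable_fun setT h -> (forall p, 0 <= h p)%E ->
  (\int[gam n]_x \int[gam n]_y h (x, lin t x (cosine t) y) =
   \int[gam n]_y \int[gam n]_x h (lin t y (cosine t) x, y))%E.
Proof.
move=> t1 mh h0.
under eq_integral => x _.
  rewrite (@integral_gauss_mehler _ _ _ _ (fun v => h (x, v)))//; last first.
    exact: measurableT_comp.
  over.
under [RHS]eq_integral => y _.
  rewrite (@integral_gauss_mehler _ _ _ _ (fun v => h (v, y)))//; last first.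
    exact: measurableT_comp.
  under eq_integral => x _ do rewrite mehlerC.
  over.
apply: (@integral_gaussC _ (fun p => h p * (mehler t p.1 p.2)%:E)%E) => [|p].
  apply: emeasurable_funM => //.
  by apply/measurable_EFinP; exact: measurable_mehler.
by rewrite mule_ge0// lee_fin mehler_ge0.
Qed.

(** Exchangeability of correlated pairs, read in the coordinates in which one
    pair is independent, is invariance under the plane rotation with cosine a
    and sine b. *)
Lemma integral_gauss_rot n a b (g : V n * V n -> \bar R) :
  0 < a -> a ^+ 2 + b ^+ 2 = 1 ->
  measurable_fun setT g -> (forall p, 0 <= g p)%E ->
  (\int[gam n]_x \int[gam n]_y g (lin a x b y, lin a y (- b) x) =
   \int[gam n]_x \int[gam n]_y g (x, y))%E.
Proof.
move=> a0 ab mg g0.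
have b1 : -1 < b < 1 by apply/andP; split; nra.
(* The exchangeable pair has correlation b, the sine of the rotation. *)
have cb : cosine b = a.
  by rewrite /cosine -ab addrK sqrtr_sqr ger0_norm// ltW.
pose h (p : V n * V n) := g (p.1, lin a^-1 p.2 (- (b / a)) p.1).
have mh : measurable_fun setT h.
  apply: (measurableT_comp mg); apply: measurable_fun_pair => //.
  exact: measurable_lin.
have := integral_gauss_corrC b1 mh (fun p => g0 _); rewrite cb.
have -> : (\int[gam n]_x \int[gam n]_y h (x, lin b x a y) =
    \int[gam n]_x \int[gam n]_y g (x, y))%E.
  apply: eq_integral => x _; apply: eq_integral => y _; rewrite /h/=.
  congr (g (_, _)); apply: eq_from_tnth => i; rewrite !tnth_mktuple.
  by field; rewrite gt_eqF.
move=> ->.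
transitivity (\int[gam n]_y \int[gam n]_x
    g (lin a x b y, lin a y (- b) x))%E.
  apply: (fubini_tonelli (m1 := gam n) (m2 := gam n)
    (fun p : V n * V n => g (lin a p.1 b p.2, lin a p.2 (- b) p.1))).
    apply: (measurableT_comp mg); apply: measurable_fun_pair;
      exact: measurable_lin.
  by move=> p; exact: g0.
apply: eq_integral => x _; apply: eq_integral => y _; rewrite /h/=.
congr (g (_, _)); apply: eq_from_tnth => i; rewrite !tnth_mktuple.
  by rewrite addrC.
apply: esym; rewrite -[X in X * _ + _]mul1r -[in X in X * _ + _]ab.
by field; rewrite gt_eqF.
Qed.

Lemma integral_gauss_conv n a b (q : V n -> \bar R) :
  0 < a -> a ^+ 2 + b ^+ 2 = 1 ->
  measurable_fun setT q -> (forall p, 0 <= q p)%E ->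
  (\int[gam n]_x \int[gam n]_y q (lin a x b y) = \int[gam n]_x q x)%E.
Proof.
move=> a0 ab mq q0.
rewrite (@integral_gauss_rot _ _ _ (fun p => q p.1))//; last first.
  exact: measurableT_comp.
apply: eq_integral => x _ /=.
by rewrite (integral_cst _ measurableT)/= probability_setT mule1.
Qed.

Lemma integral_gauss_conv_scale n a b (q : V n -> \bar R) : 0 < a ->
  measurable_fun setT q -> (forall p, 0 <= q p)%E ->
  (\int[gam n]_x \int[gam n]_y q (lin a x b y) =
   \int[gam n]_x q (lin (Num.sqrt (a ^+ 2 + b ^+ 2)) x 0 x))%E.
Proof.
move=> a0 mq q0; set d := Num.sqrt _.
have d2 : d ^+ 2 = a ^+ 2 + b ^+ 2 by rewrite sqr_sqrtr// addr_ge0 ?sqr_ge0.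
have d0 : 0 < d by rewrite sqrtr_gt0 ltr_wpDr ?sqr_ge0// exprn_gt0.
transitivity (\int[gam n]_x \int[gam n]_y
    (fun v => q (lin d v 0 v)) (lin (a / d) x (b / d) y))%E.
  apply: eq_integral => x _; apply: eq_integral => y _; congr q.
  apply: eq_from_tnth => i; rewrite !tnth_mktuple.
  by field; rewrite gt_eqF.
apply: (@integral_gauss_conv n (a / d) (b / d) (fun v => q (lin d v 0 v))).
- exact: divr_gt0.
- by rewrite !expr_div_n -mulrDl -d2 divff// gt_eqF// exprn_gt0.
- by apply: (measurableT_comp mq); exact: measurable_lin.
- by move=> p; exact: q0.
Qed.

End rotation.

Section swap4.
Context d (T : measurableType d) (R : realType) (P : probability T R).

(** Tonelli, in the form that makes x and z the two inner variables, where
    they can be rotated. *)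
Lemma ge0_integral_swap4 (D : T * T * T * T -> \bar R) :
  measurable_fun setT D -> (forall p, 0 <= D p)%E ->
  (\int[P]_x \int[P]_y \int[P]_z \int[P]_w D (x, y, z, w) =
   \int[P]_y \int[P]_w \int[P]_x \int[P]_z D (x, y, z, w))%E.
Proof.
move=> mD D0.
have m1 : measurable_fun setT
    (fun p : T * T => \int[P]_z \int[P]_w D (p.1, p.2, z, w))%E.
  apply: (measurable_fun_fubini_tonelli_F (m2 := P)
    (fun p : T * T * T => \int[P]_w D (p.1.1, p.1.2, p.2, w))%E).
    apply: (measurable_fun_fubini_tonelli_F (m2 := P)
      (fun p : T * T * T * T => D (p.1.1.1, p.1.1.2, p.1.2, p.2))) => //.
    by apply: eq_measurable_fun mD => -[[[]]].
  by move=> p; exact: integral_ge0.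
transitivity (\int[P]_y \int[P]_x \int[P]_z \int[P]_w D (x, y, z, w))%E.
  apply: (fubini_tonelli (m1 := P) (m2 := P)
    (fun p : T * T => \int[P]_z \int[P]_w D (p.1, p.2, z, w))%E) => //.
  by move=> p; do 2 apply: integral_ge0 => ? _.
apply: eq_integral => y _ /=.
transitivity (\int[P]_x \int[P]_w \int[P]_z D (x, y, z, w))%E.
  apply: eq_integral => x _.
  apply: (fubini_tonelli (m1 := P) (m2 := P)
    (fun p : T * T => D (x, y, p.1, p.2))) => //.
  apply: (measurableT_comp mD).
  by do 2 apply: measurable_fun_pair => //.
apply: (fubini_tonelli (m1 := P) (m2 := P)
  (fun p : T * T => \int[P]_z D (p.1, y, z, p.2))%E).
- apply: (measurable_fun_fubini_tonelli_F (m2 := P)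
    (fun p : T * T * T => D (p.1.1, y, p.2, p.1.2))) => //.
  apply: (measurableT_comp mD).
  by repeat apply: measurable_fun_pair => //; exact: measurableT_comp.
- by move=> p; exact: integral_ge0.
Qed.

End swap4.

Section correlated_sum.
Context {R : realType}.
Notation V n := (n.-tuple (measurableTypeR R)).
Notation gam := (@std_gaussian R).
Implicit Types (n : nat).

Lemma cosineP (r : R) : -1 < r < 1 -> r ^+ 2 + cosine r ^+ 2 = 1.
Proof. by move=> r1; rewrite sqr_cosine// addrC subrK. Qed.

(** A sum of three independent centred Gaussian vectors is centred Gaussian,
    with the sum of the variances. *)
Lemma integral_gauss_sum3 n (a b c : R) (q : V n -> \bar R) : 0 < b ->
  measurable_fun setT q -> (forall p, 0 <= q p)%E ->
  (\int[gam n]_z \int[gam n]_y \int[gam n]_w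
      q (lin 1 (lin a z b y) c w) =
   \int[gam n]_y q (lin (Num.sqrt (a ^+ 2 + b ^+ 2 + c ^+ 2)) y 0 y))%E.
Proof.
move=> b0 mq q0; set d := Num.sqrt (b ^+ 2 + c ^+ 2).
have d2 : d ^+ 2 = b ^+ 2 + c ^+ 2 by rewrite sqr_sqrtr// addr_ge0 ?sqr_ge0.
have d0 : 0 < d by rewrite sqrtr_gt0 ltr_wpDr ?sqr_ge0// exprn_gt0.
under eq_integral => z _.
  have -> : (\int[gam n]_y \int[gam n]_w q (lin 1 (lin a z b y) c w) =
      \int[gam n]_y q (lin d y a z))%E.
    transitivity (\int[gam n]_y \int[gam n]_w
        (fun v => q (lin 1 v a z)) (lin b y c w))%E.
      apply: eq_integral => y _; apply: eq_integral => w _; congr q.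
      by apply: eq_from_tnth => i; rewrite !tnth_mktuple; ring.
    rewrite (@integral_gauss_conv_scale _ _ _ _
        (fun v => q (lin 1 v a z)))//; last first.
      by apply: (measurableT_comp mq); exact: measurable_lin.
    apply: eq_integral => y _; congr q.
    by apply: eq_from_tnth => i; rewrite !tnth_mktuple -/d; ring.
  over.
rewrite (@integral_gaussC _ _ (fun p => q (lin d p.2 a p.1)))//=; last first.
  by apply: (measurableT_comp mq); exact: measurable_lin.
rewrite integral_gauss_conv_scale// d2.
by rewrite (_ : b ^+ 2 + c ^+ 2 + a ^+ 2 = a ^+ 2 + b ^+ 2 + c ^+ 2)//; ring.
Qed.

(** Mixing an s-correlated pair (x, _) and an independent t-correlated pair
    (z, _) with weights r and cosine r gives a pair of correlation
    rho = r^2 s + (1 - r^2) t. The rotation of (x, z) makes the first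
    component of the mixture one of the variables, X say; the second component
    is then rho X plus a Gaussian vector independent of X, whose variance must
    be 1 - rho^2. *)
Lemma integral_gauss_corr_add n (r s t : R) (H : V n * V n -> \bar R) :
  0 < r < 1 -> -1 < s < 1 -> -1 < t < 1 ->
  measurable_fun setT H -> (forall p, 0 <= H p)%E ->
  let rho := r ^+ 2 * s + cosine r ^+ 2 * t in
  (\int[gam n]_x \int[gam n]_y \int[gam n]_z \int[gam n]_w
     H (lin r x (cosine r) z,
        lin r (lin s x (cosine s) y) (cosine r) (lin t z (cosine t) w)) =
   \int[gam n]_x \int[gam n]_y H (x, lin rho x (cosine rho) y))%E.
Proof.
move=> /andP[r0 r1] s1 t1 mH H0 rho.
have r11 : -1 < r < 1 by rewrite r1 andbT (lt_trans _ r0)// ltrN10.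
set r' := cosine r; set s' := cosine s; set t' := cosine t.
have rr : r ^+ 2 + r' ^+ 2 = 1 := cosineP r11.
have ss : s ^+ 2 + s' ^+ 2 = 1 := cosineP s1.
have tt : t ^+ 2 + t' ^+ 2 = 1 := cosineP t1.
have s'0 : 0 < s' := cosine_gt0 s1.
pose D (p : V n * V n * V n * V n) := H (lin r p.1.1.1 r' p.1.2,
  lin r (lin s p.1.1.1 s' p.1.1.2) r' (lin t p.1.2 t' p.2)).
have mD : measurable_fun setT D.
  apply: (measurableT_comp mH); apply: measurable_fun_pair.
    by apply: measurable_lin; repeat apply: measurableT_comp => //.
  by repeat apply: measurable_lin; repeat apply: measurableT_comp => //.
(* H in the rotated variables p = (r x + r' z, r z - r' x). *)
pose g y w (p : V n * V n) := H (p.1,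
  lin r (lin s (lin r p.1 (- r') p.2) s' y) r'
    (lin t (lin r p.2 r' p.1) t' w)).
transitivity (\int[gam n]_y \int[gam n]_w \int[gam n]_x \int[gam n]_z
    D (x, y, z, w))%E; first exact: (@ge0_integral_swap4 _ _ _ (gam n) D mD (fun p => H0 _)).
transitivity (\int[gam n]_y \int[gam n]_w \int[gam n]_x \int[gam n]_z
    g y w (x, z))%E.
  apply: eq_integral => y _; apply: eq_integral => w _.
  transitivity (\int[gam n]_x \int[gam n]_z
    g y w (lin r x r' z, lin r z (- r') x))%E; last first.
    apply: integral_gauss_rot => //; last by move=> p; exact: H0.
    apply: (measurableT_comp mH); apply: measurable_fun_pair => //.
    by repeat apply: measurable_lin => //.
  apply: eq_integral => x _; apply: eq_integral => z _; rewrite /D /g/=.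
  have e (u v : R) : u = (r ^+ 2 + r' ^+ 2) * v -> u = v.
    by rewrite rr mul1r.
  congr (H (_, lin _ (lin _ _ _ _) _ (lin _ _ _ _)));
    apply: eq_from_tnth => i; rewrite !tnth_mktuple; apply: esym; apply: e;
    ring.
pose D2 (p : V n * V n * V n * V n) := g p.1.1.2 p.2 (p.1.1.1, p.1.2).
have mD2 : measurable_fun setT D2.
  apply: (measurableT_comp mH); apply: measurable_fun_pair.
    by rewrite /=; repeat apply: measurableT_comp => //.
  rewrite /=; by repeat apply: measurable_lin; repeat apply: measurableT_comp => //.
transitivity (\int[gam n]_x \int[gam n]_y \int[gam n]_z \int[gam n]_w
    D2 (x, y, z, w))%E; first by apply: esym; exact: (@ge0_integral_swap4 _ _ _ (gam n) D2 mD2 (fun p => H0 _)).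
apply: eq_integral => x _.
pose q v := H (x, lin rho x 1 v).
have mq : measurable_fun setT q.
  apply: (measurableT_comp mH); apply: measurable_fun_pair => //.
  exact: measurable_lin.
transitivity (\int[gam n]_z \int[gam n]_y \int[gam n]_w
    q (lin 1 (lin (r * r' * (t - s)) z (r * s') y) (r' * t') w))%E.
  transitivity (\int[gam n]_z \int[gam n]_y \int[gam n]_w
      D2 (x, y, z, w))%E.
    apply: (fubini_tonelli (m1 := gam n) (m2 := gam n)
      (fun p : V n * V n => \int[gam n]_w D2 (x, p.1, p.2, w))%E).
    + apply: (@measurable_integral_snd _ _ (V n * V n)%type _
        (fun p => D2 (x, p.1.1, p.1.2, p.2)))%E; last by move=> p; exact: H0.
      apply: (measurableT_comp mD2).
      by repeat apply: measurable_fun_pair => //; exact: measurableT_comp.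
    + by move=> p; apply: integral_ge0 => ? _; exact: H0.
  apply: eq_integral => z _; apply: eq_integral => y _.
  apply: eq_integral => w _; rewrite /D2 /g /q /=; congr (H (_, _)).
  by apply: eq_from_tnth => i; rewrite !tnth_mktuple /rho -/r'; ring.
rewrite integral_gauss_sum3//; [|exact: mulr_gt0|by move=> p; exact: H0].
apply: eq_integral => y _; rewrite /q; congr (H (_, _)).
have -> : Num.sqrt ((r * r' * (t - s)) ^+ 2 + (r * s') ^+ 2 + (r' * t') ^+ 2) =
    cosine rho.
  congr Num.sqrt; rewrite /rho !exprMn.
  have -> : s' ^+ 2 = 1 - s ^+ 2 by rewrite -ss addrAC subrr add0r.
  have -> : t' ^+ 2 = 1 - t ^+ 2 by rewrite -tt addrAC subrr add0r.
  have -> : r' ^+ 2 = 1 - r ^+ 2 by rewrite -rr addrAC subrr add0r.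
  by ring.
by apply: eq_from_tnth => i; rewrite !tnth_mktuple; ring.
Qed.

End correlated_sum.

(** * Bounded measurable functions *)

Definition bmeas {R : realType} d (S : measurableType d) (h : S -> R) :=
  measurable_fun setT h /\ exists C, forall x, `|h x| <= C.

Section bounded_measurable.
Context {R : realType} d (S : measurableType d).
Implicit Types (h g : S -> R) (P : probability S R).

Lemma bmeas_cst c : bmeas (fun _ : S => c : R).
Proof. by split => //; exists `|c|. Qed.

Lemma bmeasD h g : bmeas h -> bmeas g -> bmeas (fun x => h x + g x).
Proof.
move=> [mh [C hC]] [mg [D gD]]; split; first exact: measurable_funD.
by exists (C + D) => x; rewrite (le_trans (ler_normD _ _))// lerD.
Qed.

Lemma bmeasM h g : bmeas h -> bmeas g -> bmeas (fun x => h x * g x).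
Proof.
move=> [mh [C hC]] [mg [D gD]]; split; first exact: measurable_funM.
by exists (C * D) => x; rewrite normrM ler_pM.
Qed.

Lemma bmeasZ c h : bmeas h -> bmeas (fun x => c * h x).
Proof. by move=> ?; apply: bmeasM => //; exact: bmeas_cst. Qed.

Lemma bmeas_sum (I : Type) (r : seq I) (h : I -> S -> R) :
  (forall i, bmeas (h i)) -> bmeas (fun x => \sum_(i <- r) h i x).
Proof.
move=> bh; elim: r => [|i r IH].
  by under eq_fun do rewrite big_nil; exact: bmeas_cst.
by under eq_fun do rewrite big_cons; exact: bmeasD.
Qed.

Lemma bmeas_comp d' (T : measurableType d') (F : T -> S) h :
  measurable_fun setT F -> bmeas h -> bmeas (fun x => h (F x)).
Proof.
move=> mF [mh [C hC]]; split; first exact: (measurableT_comp mh mF).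
by exists C.
Qed.

Lemma bmeas_integrable P h : bmeas h -> P.-integrable setT (EFin \o h).
Proof.
move=> [mh [C hC]].
apply: (@le_integrable _ _ _ P _ measurableT _ (EFin \o cst C)).
- exact/measurable_EFinP.
- by move=> x _; rewrite lee_fin (le_trans (hC x))// ler_norm.
- exact: finite_measure_integrable_cst.
Qed.

Lemma Rintegral_cst_prob P c : \int[P]_x c = c.
Proof. by rewrite Rintegral_cst//= probability_setT mulr1. Qed.

Lemma EFin_Rintegral P h : P.-integrable setT (EFin \o h) ->
  (\int[P]_x (h x)%:E = (\int[P]_x h x)%:E)%E.
Proof. by move=> ih; rewrite /Rintegral fineK//; exact: integrable_fin_num. Qed.

Lemma normr_Rintegral_le P h C : bmeas h -> (forall x, `|h x| <= C) ->
  `|\int[P]_x h x| <= C.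
Proof.
move=> bh hC.
rewrite (le_trans (le_normr_Rintegral measurableT (bmeas_integrable P bh)))//.
rewrite -[leRHS](Rintegral_cst_prob P); apply: le_Rintegral => //.
- apply: (@bmeas_integrable P (fun x => `|h x|)); split.
    by apply: measurableT_comp => //; case: bh.
  by exists C => x; rewrite normr_id.
- exact: (bmeas_integrable P (bmeas_cst C)).
Qed.

Lemma le_Rintegral_bmeas P h g : bmeas h -> bmeas g ->
  (forall x, h x <= g x) -> \int[P]_x h x <= \int[P]_x g x.
Proof.
by move=> bh bg hg; apply: le_Rintegral => //; exact: bmeas_integrable.
Qed.

Lemma RintegralD_bmeas P h g : bmeas h -> bmeas g ->
  \int[P]_x (h x + g x) = \int[P]_x h x + \int[P]_x g x.
Proof. by move=> bh bg; rewrite RintegralD//; exact: bmeas_integrable. Qed.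

Lemma RintegralZ_bmeas P c h : bmeas h ->
  \int[P]_x (c * h x) = c * \int[P]_x h x.
Proof. by move=> bh; rewrite RintegralZl//; exact: bmeas_integrable. Qed.

Lemma Rintegral_sum P (I : Type) (r : seq I) (h : I -> S -> R) :
  (forall i, P.-integrable setT (EFin \o h i)) ->
  \int[P]_x (\sum_(i <- r) h i x) = \sum_(i <- r) \int[P]_x h i x.
Proof.
move=> ih; rewrite /Rintegral.
have -> : (\int[P]_x (\sum_(i <- r) h i x)%:E =
    \sum_(i <- r) \int[P]_x (h i x)%:E)%E.
  rewrite -integral_sum//.
  by apply: eq_integral => x _; rewrite sumEFin.
by rewrite -sum_fine// => i _; exact: integrable_fin_num (ih i).
Qed.

(** Adding the bound makes the integrand nonnegative, so that measurability
    of the partial integral is Tonelli's. *)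
Lemma bmeas_Rintegral d' (T : measurableType d') (P : probability T R)
    (h : S * T -> R) :
  bmeas h -> bmeas (fun x => \int[P]_y h (x, y)).
Proof.
move=> [mh [C hC]].
have mx x : measurable_fun setT (fun y => h (x, y)) by exact: measurableT_comp.
have ix x : P.-integrable setT (EFin \o (fun y => h (x, y))).
  apply: (@le_integrable _ _ _ P _ measurableT _ (EFin \o cst C)).
  - exact/measurable_EFinP.
  - by move=> y _; rewrite lee_fin (le_trans (hC _))// ler_norm.
  - exact: finite_measure_integrable_cst.
have iC : P.-integrable setT (EFin \o cst C).
  exact: finite_measure_integrable_cst.
have cC : \int[P]_y C = C by rewrite Rintegral_cst//= probability_setT mulr1.
split; last first.
  exists C => x; rewrite (le_trans (le_normr_Rintegral measurableT (ix x)))//.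
  rewrite -[leRHS]cC; apply: le_Rintegral => //.
  exact: (integrable_norm (ix x)).
have -> : (fun x => \int[P]_y h (x, y)) =
    (fun x => fine (\int[P]_y (h (x, y) + C)%:E)%E - C).
  apply/funext => x.
  have := RintegralD measurableT (ix x) iC.
  by rewrite /= cC {1}/Rintegral => ->; rewrite addrK.
apply: measurable_funB => //; apply: measurableT_comp => //.
apply: (measurable_fun_fubini_tonelli_F (m2 := P)
  (fun p => (h p + C)%:E)) => [|p].
  by apply/measurable_EFinP; exact: measurable_funD.
by rewrite lee_fin -lerBlDr sub0r; have := hC p; rewrite ler_norml => /andP[].
Qed.

Lemma Rintegral_iter2 d' (T : measurableType d') P (Q : probability T R)
    (h : S * T -> R) : bmeas h ->
  (\int[P]_x \int[Q]_y (h (x, y))%:E =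
   (\int[P]_x \int[Q]_y h (x, y))%:E)%E.
Proof.
move=> bh; rewrite -EFin_Rintegral; last first.
  exact: (bmeas_integrable P (bmeas_Rintegral Q bh)).
apply: eq_integral => x _; rewrite /Rintegral fineK//.
apply: integrable_fin_num => //.
have [mh [C hC]] := bh.
apply: (@le_integrable _ _ _ Q _ measurableT _ (EFin \o cst C)).
- by apply/measurable_EFinP; exact: measurableT_comp.
- by move=> y _; rewrite lee_fin (le_trans (hC _))// ler_norm.
- exact: finite_measure_integrable_cst.
Qed.

End bounded_measurable.

(** * The noise correlation and the Ornstein-Uhlenbeck averages *)

Section measurable_Rintegral.
Context {R : realType} d (S : measurableType d) d' (T : measurableType d').

Lemma measurable_Rintegral (Q : probability T R) (h : S * T -> R) :
  measurable_fun setT h -> measurable_fun setT (fun x => \int[Q]_y h (x, y)).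
Proof.
move=> mh; apply: measurableT_comp => //.
have mE : measurable_fun setT (EFin \o h) by exact/measurable_EFinP.
rewrite (_ : (fun x => _) = fun x =>
  (\int[Q]_y ((EFin \o h)^\+)%E (x, y) - \int[Q]_y ((EFin \o h)^\-)%E (x, y))%E);
  last first.
  apply/funext => x; rewrite integralE; congr (_ - _)%E.
    by apply: eq_integral => y _; rewrite !funeposE.
  by apply: eq_integral => y _; rewrite !funenegE.
apply: emeasurable_funB.
- apply: (measurable_fun_fubini_tonelli_F (m2 := Q) ((EFin \o h)^\+)%E) => //.
  exact: measurable_funepos.
- apply: (measurable_fun_fubini_tonelli_F (m2 := Q) ((EFin \o h)^\-)%E) => //.
  exact: measurable_funeneg.
Qed.

End measurable_Rintegral.

Section measurable_proj4.
Context d (S : measurableType d).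
Local Notation S4 := (S * S * S * S)%type.

Lemma measurable_proj4_1 : measurable_fun setT (fun p : S4 => p.1.1.1).
Proof.
apply: (measurableT_comp (@measurable_fst _ _ S S)).
exact: (measurableT_comp (@measurable_fst _ _ (S * S)%type S)).
Qed.

Lemma measurable_proj4_2 : measurable_fun setT (fun p : S4 => p.1.1.2).
Proof.
apply: (measurableT_comp (@measurable_snd _ _ S S)).
exact: (measurableT_comp (@measurable_fst _ _ (S * S)%type S)).
Qed.

Lemma measurable_proj4_3 : measurable_fun setT (fun p : S4 => p.1.2).
Proof. exact: (measurableT_comp (@measurable_snd _ _ (S * S)%type S)). Qed.

Lemma measurable_proj4_4 : measurable_fun setT (fun p : S4 => p.2).
Proof. exact: measurable_snd. Qed.

End measurable_proj4.

Section correlation.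
Context {R : realType}.
Notation V n := (n.-tuple (measurableTypeR R)).
Notation gam := (@std_gaussian R).
Implicit Types (n : nat).

(** E [u(X) v(Y)] for standard Gaussian vectors X and Y of correlation rho. *)
Definition corr n (u v : V n -> R) (rho : R) : R :=
  \int[gam n]_x \int[gam n]_y (u x * v (lin rho x (cosine rho) y)).

(** The Ornstein-Uhlenbeck semigroup at time - ln r. *)
Definition ou n (r : R) (u : V n -> R) (x : V n) : R :=
  \int[gam n]_z u (lin r x (cosine r) z).

(** The j-th partial derivative of u, averaged by [ou r]. The formula is its
    integration by parts, which needs no derivative of u and shows that the
    average is bounded when u is. *)
Definition ou_grad n (r : R) (j : 'I_n) (u : V n -> R) (x : V n) : R :=
  (cosine r)^-1 * \int[gam n]_z (u (lin r x (cosine r) z) * tnth z j).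

Lemma bmeas_ou n r (u : V n -> R) : bmeas u -> bmeas (ou r u).
Proof.
move=> bu; apply: (@bmeas_Rintegral _ _ _ _ _ _ (fun p => u (lin r p.1 (cosine r) p.2))).
by apply: bmeas_comp bu; exact: measurable_lin.
Qed.

Lemma corr0 n (u v : V n -> R) : bmeas u -> bmeas v ->
  corr u v 0 = (\int[gam n]_x u x) * \int[gam n]_x v x.
Proof.
move=> bu bv; rewrite /corr.
have c0 : cosine (0 : R) = 1 by rewrite /cosine expr0n subr0 sqrtr1.
transitivity (\int[gam n]_x (u x * \int[gam n]_y v y)); last first.
  under eq_Rintegral do rewrite mulrC.
  by rewrite RintegralZ_bmeas// mulrC.
apply: eq_Rintegral => x _; rewrite -RintegralZ_bmeas//.
apply: eq_Rintegral => y _; congr (_ * v _).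
by apply: eq_from_tnth => i; rewrite tnth_mktuple c0 mul0r mul1r add0r.
Qed.

(** The correlation at r^2 s + (1 - r^2) t is an average over s-correlated
    pairs of correlations at level t: small variations of t, hence of the
    correlation around r^2 s, are seen as variations around 0. *)
Lemma corr_add n (r s t : R) (u v : V n -> R) :
  0 < r < 1 -> -1 < s < 1 -> -1 < t < 1 ->
  bmeas u -> bmeas v -> (forall x, 0 <= u x) -> (forall x, 0 <= v x) ->
  corr u v (r ^+ 2 * s + cosine r ^+ 2 * t) =
  \int[gam n]_x \int[gam n]_y
    corr (fun z => u (lin r x (cosine r) z))
      (fun w => v (lin r (lin s x (cosine s) y) (cosine r) w)) t.
Proof.
move=> r01 s1 t1 bu bv u0 v0.
have := integral_gauss_corr_add r01 s1 t1.
set rho := r ^+ 2 * s + _; set r' := cosine r; set s' := cosine s.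
move=> /(_ n (fun p => (u p.1 * v p.2)%:E)) H.
have bH : bmeas (fun p : V n * V n => u p.1 * v p.2).
  by apply: bmeasM; [apply: bmeas_comp bu|apply: bmeas_comp bv].
apply: EFin_inj.
transitivity (\int[gam n]_x \int[gam n]_y
    (u x * v (lin rho x (cosine rho) y))%:E)%E.
  apply: esym; apply: (@Rintegral_iter2 _ _ _ _ _ _ _
    (fun p : V n * V n => u p.1 * v (lin rho p.1 (cosine rho) p.2))).
  apply: bmeasM; first exact: bmeas_comp bu.
  by apply: bmeas_comp bv; exact: measurable_lin.
rewrite -H; last 2 first.
- by apply/measurable_EFinP; case: bH.
- by move=> p; rewrite lee_fin mulr_ge0.
pose D (p : V n * V n * V n * V n) := u (lin r p.1.1.1 r' p.1.2) *
  v (lin r (lin s p.1.1.1 s' p.1.1.2) r' (lin t p.1.2 (cosine t) p.2)).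
have bD : bmeas D.
  apply: bmeasM; [apply: bmeas_comp bu|apply: bmeas_comp bv].
    by apply: measurable_lin; [exact: measurable_proj4_1|exact: measurable_proj4_3].
  apply: measurable_lin; apply: measurable_lin.
  - exact: measurable_proj4_1.
  - exact: measurable_proj4_2.
  - exact: measurable_proj4_3.
  - exact: measurable_proj4_4.
transitivity (\int[gam n]_x \int[gam n]_y
    (\int[gam n]_z \int[gam n]_w D (x, y, z, w))%:E)%E.
  apply: eq_integral => x _; apply: eq_integral => y _.
  apply: (@Rintegral_iter2 _ _ _ _ _ _ _ (fun p : V n * V n => D (x, y, p.1, p.2))).
  by apply: bmeas_comp bD; do 2 apply: measurable_fun_pair => //.
apply: (@Rintegral_iter2 _ _ _ _ _ _ _ (fun p : V n * V n =>
  \int[gam n]_z \int[gam n]_w D (p.1, p.2, z, w))).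
apply: (@bmeas_Rintegral _ _ _ _ _ _ (fun p : V n * V n * V n =>
  \int[gam n]_w D (p.1.1, p.1.2, p.2, w))).
apply: (@bmeas_Rintegral _ _ _ _ _ _ (fun p : V n * V n * V n * V n =>
  D (p.1.1.1, p.1.1.2, p.1.2, p.2))).
by rewrite (_ : (fun p => _) = D).
Qed.

(** Averaging both functions lowers the correlation level by a factor r^2
    (semigroup property). *)
Lemma corr_ou n (r s : R) (u v : V n -> R) :
  0 < r < 1 -> -1 < s < 1 ->
  bmeas u -> bmeas v -> (forall x, 0 <= u x) -> (forall x, 0 <= v x) ->
  corr (ou r u) (ou r v) s = corr u v (r ^+ 2 * s).
Proof.
move=> r01 s1 bu bv u0 v0.
have z1 : -1 < (0 : R) < 1 by rewrite ltrN10 ltr01.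
have e := @corr_add n r s 0 u v r01 s1 z1 bu bv u0 v0.
rewrite mulr0 addr0 in e; rewrite e.
apply: eq_Rintegral => x _; apply: eq_Rintegral => y _.
apply: esym; apply: (@corr0 n (fun z => u (lin r x (cosine r) z))
  (fun w => v (lin r (lin s x (cosine s) y) (cosine r) w))).
- by apply: bmeas_comp bu; exact: measurable_lin.
- by apply: bmeas_comp bv; exact: measurable_lin.
Qed.

Lemma Rintegral_gauss_conv n (a b : R) (q : V n -> R) :
  0 < b -> a ^+ 2 + b ^+ 2 = 1 -> bmeas q -> (forall x, 0 <= q x) ->
  \int[gam n]_x \int[gam n]_y q (lin a x b y) = \int[gam n]_x q x.
Proof.
move=> b0 ab bq q0; apply: EFin_inj.
rewrite -[RHS]EFin_Rintegral; last exact: bmeas_integrable.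
have mq : measurable_fun setT (EFin \o q) by apply/measurable_EFinP; case: bq.
have q0E x : (0 <= (EFin \o q) x)%E by rewrite lee_fin.
have ba : b ^+ 2 + a ^+ 2 = 1 by rewrite addrC.
transitivity (\int[gam n]_x \int[gam n]_y (EFin \o q) (lin b x a y))%E; last first.
  exact: integral_gauss_conv.
transitivity (\int[gam n]_x \int[gam n]_y (q (lin a x b y))%:E)%E.
  apply: esym; apply: (@Rintegral_iter2 _ _ _ _ _ _ _
    (fun p : V n * V n => q (lin a p.1 b p.2))).
  by apply: bmeas_comp bq; exact: measurable_lin.
transitivity (\int[gam n]_y \int[gam n]_x (q (lin a x b y))%:E)%E.
  apply: (fubini_tonelli (m1 := gam n) (m2 := gam n)
    (fun p : V n * V n => (q (lin a p.1 b p.2))%:E)) => [|p].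
    apply/measurable_EFinP; apply: (measurableT_comp (proj1 bq)).
    exact: measurable_lin.
  by rewrite lee_fin.
apply: eq_integral => x _; apply: eq_integral => y _; rewrite /=; congr (q _)%:E.
by apply: eq_from_tnth => i; rewrite !tnth_mktuple addrC.
Qed.

End correlation.

(** * First-order expansion of the Mehler kernel *)

Section mehler_expansion.
Context {R : realType}.
Notation V n := (n.-tuple (measurableTypeR R)).
Implicit Types (n : nat).

Lemma sqr_normr (x : R) : `|x| ^+ 2 = x ^+ 2.
Proof. by rewrite real_normK ?num_real. Qed.

(** The remainder is dominated by an exponential of the same argument, which
    is what stays integrable under the Gaussian measure. *)
Lemma expR_taylor1 (p : R) : `|expR p - 1 - p| <= p ^+ 2 * expR `|p|.
Proof.
have h1 := expR_ge1Dx p; have h2 := expR_ge1Dx (- p).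
have e0 := expR_gt0 p.
have h3 : expR p - 1 <= p * expR p.
  have : (1 - p) * expR p <= expR (- p) * expR p by rewrite ler_pM2r.
  by rewrite -expRD addNr expR0; lra.
rewrite ger0_norm; last by lra.
have [p0|p0] := lerP 0 p.
  by rewrite ger0_norm//; nra.
rewrite ltr0_norm// (@le_trans _ _ (p ^+ 2))//; first by nra.
by rewrite ler_peMr ?sqr_ge0// -expR0 ler_expR; lra.
Qed.

Definition dot n (x y : V n) : R := \sum_(i < n) tnth x i * tnth y i.

Definition sqn n (x : V n) : R := \sum_(i < n) tnth x i ^+ 2.

Lemma sqn_ge0 n (x : V n) : 0 <= sqn x.
Proof. by apply: sumr_ge0 => i _; exact: sqr_ge0. Qed.

Lemma dot_le_sqn n (x y : V n) : 2 * `|dot x y| <= sqn x + sqn y.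
Proof.
rewrite -big_split/= (le_trans (ler_wpM2l _ (ler_norm_sum _ _ _)))//.
rewrite mulr_sumr; apply: ler_sum => i _; rewrite normrM.
rewrite -(sqr_normr (tnth x i)) -(sqr_normr (tnth y i)).
by have h := sqr_ge0 (`|tnth x i| - `|tnth y i|); rewrite sqrrB in h; lra.
Qed.

Lemma mehlerE n t (x y : V n) : mehler t x y = (cosine t)^-1 ^+ n *
  expR ((2 * t * dot x y - t ^+ 2 * (sqn x + sqn y)) / (2 * (1 - t ^+ 2))).
Proof.
rewrite /mehler big_split/= prodr_const card_ord; congr (_ * _).
rewrite -expR_sum; congr expR; rewrite -mulr_suml; congr (_ / _).
by rewrite /dot /sqn -big_split/= !mulr_sumr sumrB.
Qed.

Lemma cosine_expn_le n (t : R) : `|t| <= 1 / 8 ->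
  1 <= (cosine t)^-1 ^+ n <= 1 + 2 * n%:R * expR (2 * n%:R) * t ^+ 2.
Proof.
move=> t8; have t2 : t ^+ 2 <= 1 / 64.
  by rewrite -sqr_normr; have := normr_ge0 t; nra.
have t0 : 0 <= t ^+ 2 := sqr_ge0 t.
have c0 : 0 < cosine t by rewrite sqrtr_gt0; lra.
have c2 : cosine t ^+ 2 = 1 - t ^+ 2 by rewrite sqr_sqrtr//; lra.
have c1 : cosine t <= 1 by nra.
have ci1 : 1 <= (cosine t)^-1 by rewrite invf_ge1.
have ci2 : (cosine t)^-1 <= expR (2 * t ^+ 2).
  apply: (@le_trans _ _ (1 + 2 * t ^+ 2)); last exact: expR_ge1Dx.
  rewrite -(ler_pM2l c0) mulfV ?gt_eqF//.
  have : cosine t ^+ 2 <= cosine t by nra.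
  by nra.
apply/andP; split; first exact: exprn_ege1.
apply: (@le_trans _ _ (expR (2 * t ^+ 2) ^+ n)).
  by apply: lerXn2r; rewrite ?nnegrE ?expR_ge0// ltW// invr_gt0.
rewrite -expRM_natl.
set N := n%:R * _; have N0 : 0 <= N by rewrite mulr_ge0 ?ler0n// mulr_ge0 ?sqr_ge0.
have Nn : N <= 2 * n%:R.
  by rewrite /N mulrC ler_wpM2r ?ler0n//; lra.
apply: (@le_trans _ _ (1 + N * expR N)).
  have := expR_ge1Dx (- N); have e0 := expR_gt0 N => h2.
  have : (1 - N) * expR N <= expR (- N) * expR N by rewrite ler_pM2r.
  by rewrite -expRD addNr expR0; lra.
rewrite lerD2l (@le_trans _ _ (N * expR (2 * n%:R)))//.
  by rewrite ler_wpM2l// ler_expR.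
by rewrite le_eqVlt; apply/orP; left; apply/eqP; rewrite /N; ring.
Qed.

(** Only the term t (x . y) of the exponent is of first order in t. The radius
    1/8 keeps the exponential factors of the remainder below the exponent 3/8,
    so that the remainder is integrable in x and y. *)
Lemma mehler_expansion n t (x y : V n) : `|t| <= 1 / 8 ->
  `|mehler t x y - 1 - t * dot x y| <=
  (2 * n%:R * expR (2 * n%:R) + 264) * t ^+ 2 *
    expR (3 / 8 * (sqn x + sqn y)).
Proof.
move=> t8; have /andP[k1 k2] := cosine_expn_le n t8.
rewrite mehlerE; set k := _ ^+ n in k1 k2 *; set N := 2 * _ * expR _ in k2 *.
have N0 : 0 <= N by rewrite /N !mulr_ge0 ?ler0n ?expR_ge0.
have S0 : 0 <= sqn x + sqn y by rewrite addr_ge0 ?sqn_ge0.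
have aS := dot_le_sqn x y.
set S := sqn x + sqn y in S0 aS *; set a := dot x y in aS *.
set p := (2 * t * a - t ^+ 2 * S) / (2 * (1 - t ^+ 2)).
have t2 : t ^+ 2 <= 1 / 64.
  by rewrite -sqr_normr; have := normr_ge0 t; nra.
have tt : t ^+ 2 = `|t| ^+ 2 by rewrite sqr_normr.
have at0 := normr_ge0 t.
have aa : `|t * a| <= `|t| * S / 2.
  by rewrite normrM; nra.
have pa : `|p - t * a| <= t ^+ 2 * S.
  have -> : p - t * a = t ^+ 2 * ((2 * (t * a) - S) / (2 * (1 - t ^+ 2))).
    by rewrite /p; field; lra.
  rewrite normrM ger0_norm ?sqr_ge0// ler_wpM2l ?sqr_ge0//.
  rewrite normrM normfV [X in _ / X]ger0_norm; last by lra.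
  rewrite ler_pdivrMr; last by lra.
  apply: (@le_trans _ _ (2 * `|t * a| + S)).
    by rewrite (le_trans (ler_normB _ _))// (ger0_norm S0) lerD2r normrM ger0_norm.
  by nra.
have t3 : t ^+ 2 <= `|t| / 8 by rewrite tt; nra.
have t3S : t ^+ 2 * S <= `|t| / 8 * S by rewrite ler_wpM2r.
have tS0 : 0 <= `|t| * S by rewrite mulr_ge0.
have pt1 : `|p| <= `|t| * S.
  have -> : p = (p - t * a) + t * a by ring.
  by rewrite (le_trans (ler_normD _ _))//; lra.
have pt : `|p| <= S / 8.
  have : `|t| * S <= 1 / 8 * S by rewrite ler_wpM2r.
  lra.
have pt2 : p ^+ 2 <= t ^+ 2 * S ^+ 2.
  rewrite -sqr_normr tt -exprMn; apply: lerXn2r => //; rewrite nnegrE//.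
have eS : expR `|p| <= expR (S / 8) by rewrite ler_expR.
have eS' : expR p <= expR (S / 8) by rewrite ler_expR (le_trans (ler_norm _)).
set E := expR (S / 8) in eS eS' *.
have E1 : 1 + S / 8 <= E := expR_ge1Dx _.
(* The constant 264 is 256 + 8, from S^2 <= 256 E and S <= 8 E. *)
have SE : S ^+ 2 <= 256 * E.
  have -> : E = expR (S / 16) ^+ 2.
    by rewrite -expRM_natl; congr expR; field.
  by have := expR_ge1Dx (S / 16); nra.
have E3 : expR (3 / 8 * S) = E ^+ 3.
  by rewrite -expRM_natl; congr expR; field.
have E1' : 1 <= E by lra.
have E2 : E <= E ^+ 2 by nra.
have E3' : E ^+ 2 <= E ^+ 3 by nra.
have h1 : `|(k - 1) * expR p| <= N * t ^+ 2 * E.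
  by rewrite normrM !ger0_norm ?subr_ge0 ?expR_ge0// ler_pM ?expR_ge0//; lra.
have h2 : `|expR p - 1 - p| <= t ^+ 2 * (256 * E ^+ 2).
  rewrite (le_trans (expR_taylor1 _))//.
  apply: (@le_trans _ _ (t ^+ 2 * S ^+ 2 * E)).
    by rewrite ler_pM ?sqr_ge0 ?expR_ge0.
  by rewrite -mulrA ler_wpM2l ?sqr_ge0//; nra.
have -> : k * expR p - 1 - t * a =
    (k - 1) * expR p + (expR p - 1 - p) + (p - t * a) by ring.
have h3 : t ^+ 2 * S <= t ^+ 2 * (8 * E) by rewrite ler_wpM2l ?sqr_ge0//; lra.
rewrite E3; apply: (@le_trans _ _
    (N * t ^+ 2 * E + t ^+ 2 * (256 * E ^+ 2) + t ^+ 2 * (8 * E))).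
  by rewrite (le_trans (ler_normD _ _))// lerD ?(le_trans pa)//
    (le_trans (ler_normD _ _))// lerD.
have Nt : 0 <= N * t ^+ 2 by rewrite mulr_ge0 ?sqr_ge0.
have t0 := sqr_ge0 t.
have g1 : N * t ^+ 2 * E <= N * t ^+ 2 * E ^+ 3.
  by rewrite ler_wpM2l// (le_trans E2).
have g2 : t ^+ 2 * E <= t ^+ 2 * E ^+ 3 by rewrite ler_wpM2l// (le_trans E2).
have g3 : t ^+ 2 * E ^+ 2 <= t ^+ 2 * E ^+ 3 by rewrite ler_wpM2l.
by lra.
Qed.

End mehler_expansion.

Section domination.
Context {R : realType} d (S : measurableType d) (P : probability S R).
Implicit Types (g h : S -> R).

Lemma integrable_dominated h g : measurable_fun setT h ->
  P.-integrable setT (EFin \o g) -> (forall x, `|h x| <= g x) ->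
  P.-integrable setT (EFin \o h).
Proof.
move=> mh ig hg; apply: (@le_integrable _ _ _ P _ measurableT _ (EFin \o g)) => //.
  exact/measurable_EFinP.
by move=> x _; rewrite lee_fin (le_trans (hg x))// ler_norm.
Qed.

Lemma normr_Rintegral_dominated h g : measurable_fun setT h ->
  P.-integrable setT (EFin \o g) -> (forall x, `|h x| <= g x) ->
  `|\int[P]_x h x| <= \int[P]_x g x.
Proof.
move=> mh ig hg; have ih := integrable_dominated mh ig hg.
rewrite (le_trans (le_normr_Rintegral measurableT ih))//.
by apply: le_Rintegral => //; exact: (integrable_norm ih).
Qed.

Lemma integrableZl_EFin c h : P.-integrable setT (EFin \o h) ->
  P.-integrable setT (EFin \o (fun x => c * h x)).
Proof.
move=> ih; exact: (integrableZl measurableT c ih).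
Qed.

Lemma integrableD_EFin g h : P.-integrable setT (EFin \o g) ->
  P.-integrable setT (EFin \o h) ->
  P.-integrable setT (EFin \o (fun x => g x + h x)).
Proof.
move=> ig ih; exact: (integrableD measurableT ig ih).
Qed.

Lemma integrable_sum_EFin (I : Type) (r : seq I) (h : I -> S -> R) :
  (forall i, P.-integrable setT (EFin \o h i)) ->
  P.-integrable setT (EFin \o (fun x => \sum_(i <- r) h i x)).
Proof.
move=> ih; elim: r => [|i r IH].
  rewrite (_ : (fun x => \sum_(i <- [::]) h i x) = (fun=> 0 : R)).
    refine (bmeas_integrable P (bmeas_cst S 0)).
  by apply/funext => x; rewrite big_nil.
rewrite (_ : (fun x => \sum_(i <- i :: r) h i x) =
    fun x => h i x + \sum_(i <- r) h i x).
  exact: integrableD_EFin.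
by apply/funext => x; rewrite big_cons.
Qed.

(** The moments E [u(Z) Z_j] of a bounded function u are of this form. *)
Lemma integrable_bmeasM g h : bmeas g -> P.-integrable setT (EFin \o h) ->
  P.-integrable setT (EFin \o (fun x => g x * h x)).
Proof.
move=> [mg [C gC]] ih; have [/measurable_EFinP mh _] := integrableP _ _ _ ih.
apply: (@integrable_dominated _ (fun x => C * `|h x|)).
- exact: measurable_funM.
- by apply: integrableZl_EFin; exact: (integrable_norm ih).
- by move=> x; rewrite normrM ler_wpM2r.
Qed.

End domination.

Section corr_expansion.
Context {R : realType}.
Notation V n := (n.-tuple (measurableTypeR R)).
Notation gam1 := (@normal_prob R 0 1).
Notation gam := (@std_gaussian R).
Implicit Types (n : nat).

Lemma gauss_coord_abs_le1 n (j : 'I_n) :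
  (\int[gam n]_x (`|tnth x j|)%:E <= 1)%E.
Proof.
pose h (i : 'I_n) (x : R) := if i == j then `|x| else 1.
have -> : (\int[gam n]_x (`|tnth x j|)%:E =
    \int[gam n]_x (\prod_(i < n) h i (tnth x i))%:E)%E.
  apply: eq_integral => x _; rewrite (bigD1 j)//= /h eqxx big1 ?mulr1//.
  by move=> i /negbTE ->.
rewrite integral_gauss_prod; last 2 first.
- move=> i; rewrite /h; case: (i == j); last exact: measurable_cst.
  by apply: continuous_measurable_fun; exact: norm_continuous.
- by move=> i x; rewrite /h; case: ifP.
rewrite (bigD1 j)//= big1 ?mule1; first last.
  move=> i /negbTE ij; rewrite /h ij.
  by rewrite (integral_cst _ measurableT)/= probability_setT mule1.
by rewrite /h eqxx; exact: gauss1_abs_le1.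
Qed.

Lemma integrable_gauss_coord n (j : 'I_n) :
  (gam n).-integrable setT (EFin \o (fun x => tnth x j)).
Proof.
apply/integrableP; split.
  by apply/measurable_EFinP; exact: measurable_tnth.
by rewrite (le_lt_trans (gauss_coord_abs_le1 j))// ltry.
Qed.

Lemma gauss_sqn_exp_lty n :
  (gam n).-integrable setT (EFin \o (fun x => expR (3 / 8 * sqn x))).
Proof.
apply/integrableP; split.
  apply/measurable_EFinP; apply: measurableT_comp => //.
  apply: measurable_funM => //.
  apply: measurable_sum => i.
  by apply: measurable_funX; exact: measurable_tnth.
have -> : (\int[gam n]_x `|(EFin \o (fun x => expR (3 / 8 * sqn x))) x| =
    \int[gam n]_x (\prod_(i < n) expR (3 / 8 * tnth x i ^+ 2))%:E)%E.
  apply: eq_integral => x _; rewrite /= ger0_norm ?expR_ge0//; congr EFin.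
  by rewrite -expR_sum /sqn mulr_sumr.
rewrite (@integral_gauss_prod _ _ (fun _ x => expR (3 / 8 * x ^+ 2))); last 2 first.
- move=> i; apply: measurableT_comp => //; apply: measurable_funM => //.
- by move=> i x; exact: expR_ge0.
have : (0 <= \int[gam1]_x (expR (3 / 8 * x ^+ 2))%:E)%E.
  by apply: integral_ge0 => x _; rewrite lee_fin expR_ge0.
have := @gauss1_sqr_exp_lty R.
case: (\int[gam1]_x _)%E => // r _ _.
by rewrite prodEFin ltry.
Qed.

Lemma Rintegral_gauss_mehler n t (x : V n) (B : V n -> R) : -1 < t < 1 ->
  bmeas B -> (forall y, 0 <= B y) ->
  \int[gam n]_y B (lin t x (cosine t) y) = \int[gam n]_y (B y * mehler t x y).
Proof.
move=> t1 [mB _] B0; congr fine.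
rewrite (@integral_gauss_mehler _ _ _ _ (EFin \o B))//.
exact/measurable_EFinP.
Qed.

Lemma integrable_mehler n t (x : V n) : -1 < t < 1 ->
  (gam n).-integrable setT (EFin \o (fun y => mehler t x y)).
Proof.
move=> t1; apply/integrableP; split.
  by apply/measurable_EFinP; exact: measurable_mehler.
have -> : (\int[gam n]_y `|(EFin \o (fun y => mehler t x y)) y| =
    \int[gam n]_y (cst 1 y * (mehler t x y)%:E))%E.
  by apply: eq_integral => y _; rewrite mul1e /= ger0_norm ?mehler_ge0.
rewrite -(integral_gauss_mehler x t1)//.
by rewrite (integral_cst _ measurableT)/= probability_setT mule1 ltry.
Qed.

Lemma measurable_dot d (S : measurableType d) n (F G : S -> V n) :
  measurable_fun setT F -> measurable_fun setT G ->
  measurable_fun setT (fun p => dot (F p) (G p)).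
Proof.
move=> mF mG; apply: measurable_sum => i.
by apply: measurable_funM; exact: measurable_tnth_comp.
Qed.

Lemma Rintegral_gauss_dot n (A : V n -> R) (x : V n) : bmeas A ->
  (gam n).-integrable setT (EFin \o (fun y => A y * dot x y)) /\
  \int[gam n]_y (A y * dot x y) =
  \sum_(j < n) tnth x j * \int[gam n]_y (A y * tnth y j).
Proof.
move=> bA.
have iA j : (gam n).-integrable setT (EFin \o (fun y => A y * tnth y j)).
  by apply: integrable_bmeasM => //; exact: integrable_gauss_coord.
have iAx j : (gam n).-integrable setT
    (EFin \o (fun y => tnth x j * (A y * tnth y j))).
  exact: integrableZl_EFin.
have e : (fun y => A y * dot x y) =
    (fun y => \sum_(j < n) tnth x j * (A y * tnth y j)).
  apply/funext => y; rewrite /dot mulr_sumr; apply: eq_bigr => j _.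
  by rewrite mulrCA.
rewrite e; split; first exact: integrable_sum_EFin.
rewrite Rintegral_sum//; apply: eq_bigr => j _.
by rewrite RintegralZl.
Qed.

(** Integrating the expansion of the Mehler kernel against the two functions.
    The constant C is uniform in A and B, which makes it possible to average
    the estimate over families of functions. *)
Lemma corr_expansion n : exists C : R, 0 <= C /\
  forall (A B : V n -> R) CA CB t,
  bmeas A -> bmeas B -> (forall x, 0 <= B x) ->
  (forall x, `|A x| <= CA) -> (forall x, `|B x| <= CB) -> `|t| <= 1 / 8 ->
  `|corr A B t - (\int[gam n]_x A x * \int[gam n]_x B x +
     t * \sum_(j < n) (\int[gam n]_x (A x * tnth x j)) *
                      (\int[gam n]_x (B x * tnth x j)))| <=
  CA * CB * C * t ^+ 2.
Proof.
pose Q (x : V n) : R := expR (3 / 8 * sqn x).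
have iQ : (gam n).-integrable setT (EFin \o Q) := gauss_sqn_exp_lty n.
pose q := \int[gam n]_x Q x.
have q0 : 0 <= q by apply: Rintegral_ge0 => x _; exact: expR_ge0.
pose C0 : R := 2 * n%:R * expR (2 * n%:R) + 264.
have C00 : 0 <= C0 by apply: addr_ge0; [rewrite mulr_ge0 ?expR_ge0// mulr_ge0 ?ler0n|rewrite ler0n].
exists (C0 * q * q); split; first by rewrite !mulr_ge0.
move=> A B CA CB t bA bB B0 hA hB t8.
have CA0 : 0 <= CA.
  by rewrite (le_trans _ (hA [tuple 0 | i < n]))// normr_ge0.
have CB0 : 0 <= CB.
  by rewrite (le_trans _ (hB [tuple 0 | i < n]))// normr_ge0.
have t1 : -1 < t < 1.
  by rewrite -ltr_norml; apply: (le_lt_trans t8); lra.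
set S := \sum_(j < n) _.
pose D x := \int[gam n]_y B (lin t x (cosine t) y).
pose L x := \int[gam n]_y B y + t * \sum_(j < n) tnth x j *
  \int[gam n]_y (B y * tnth y j).
have bD : bmeas D.
  apply: (@bmeas_Rintegral _ _ _ _ _ _ (fun p => B (lin t p.1 (cosine t) p.2))).
  by apply: bmeas_comp bB; exact: measurable_lin.
have DL x : `|D x - L x| <= CB * C0 * t ^+ 2 * q * Q x.
  have [iBd eBd] := Rintegral_gauss_dot x bB.
  have iB1 : (gam n).-integrable setT (EFin \o B) := bmeas_integrable _ bB.
  have iBk : (gam n).-integrable setT (EFin \o (fun y => B y * mehler t x y)).
    by apply: integrable_bmeasM => //; exact: integrable_mehler.
  have iBtd : (gam n).-integrable setT
      (EFin \o (fun y => t * (B y * dot x y))) by exact: integrableZl_EFin.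
  have iL : (gam n).-integrable setT
      (EFin \o (fun y => B y + t * (B y * dot x y))) by exact: integrableD_EFin.
  have -> : D x - L x =
      \int[gam n]_y (B y * mehler t x y - (B y + t * (B y * dot x y))).
    rewrite RintegralB// RintegralD// RintegralZl// eBd.
    by rewrite /D Rintegral_gauss_mehler.
  rewrite [leRHS]mulrAC -RintegralZl//.
  apply: normr_Rintegral_dominated.
  - have mB : measurable_fun setT B by case: bB.
    apply: measurable_funB.
      by apply: measurable_funM => //; exact: measurable_mehler.
    apply: measurable_funD => //; apply: measurable_funM => //.
    by apply: measurable_funM => //; exact: measurable_dot.
  - exact: integrableZl_EFin.
  - move=> y.
    have -> : B y * mehler t x y - (B y + t * (B y * dot x y)) =
      B y * (mehler t x y - 1 - t * dot x y) by ring.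
    rewrite normrM; have := mehler_expansion x y t8.
    rewrite mulrDr expRD -/(Q x) -/(Q y) -/C0 => h.
    apply: (@le_trans _ _ (CB * (C0 * t ^+ 2 * (Q x * Q y)))).
      by rewrite ler_pM.
    by rewrite le_eqVlt; apply/orP; left; apply/eqP; ring.
have iA1 : (gam n).-integrable setT (EFin \o A) := bmeas_integrable _ bA.
have iAj j : (gam n).-integrable setT (EFin \o (fun y => A y * tnth y j)).
  by apply: integrable_bmeasM => //; exact: integrable_gauss_coord.
have eAL : (fun x => A x * L x) = (fun x => (\int[gam n]_y B y) * A x +
    t * \sum_(j < n) (\int[gam n]_y (B y * tnth y j)) * (A x * tnth x j)).
  apply/funext => x; rewrite /L mulrDr mulrC; congr (_ + _).
  rewrite mulrCA; congr (_ * _); rewrite mulr_sumr; apply: eq_bigr => j _.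
  by rewrite mulrA mulrC.
have iS : (gam n).-integrable setT (EFin \o (fun x =>
    \sum_(j < n) (\int[gam n]_y (B y * tnth y j)) * (A x * tnth x j))).
  by apply: integrable_sum_EFin => j; exact: integrableZl_EFin.
have iAL : (gam n).-integrable setT (EFin \o (fun x => A x * L x)).
  rewrite eAL; apply: integrableD_EFin; first exact: integrableZl_EFin.
  exact: integrableZl_EFin.
have AL : \int[gam n]_x (A x * L x) =
    \int[gam n]_x A x * \int[gam n]_x B x + t * S.
  rewrite eAL RintegralD//; [|exact: integrableZl_EFin..].
  congr (_ + _); first by rewrite RintegralZl// mulrC.
  rewrite RintegralZl//; congr (_ * _).
  rewrite Rintegral_sum//; last by move=> j; exact: integrableZl_EFin.
  by apply: eq_bigr => j _; rewrite RintegralZl// mulrC.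
have AD : corr A B t = \int[gam n]_x (A x * D x).
  apply: eq_Rintegral => x _; rewrite -RintegralZ_bmeas//.
  by apply: bmeas_comp bB; exact: measurable_lin.
have iAD : (gam n).-integrable setT (EFin \o (fun x => A x * D x)).
  by apply: bmeas_integrable; exact: bmeasM.
rewrite AD -AL -RintegralB//.
have -> : CA * CB * (C0 * q * q) * t ^+ 2 = CA * CB * C0 * t ^+ 2 * q * q by ring.
rewrite /q -RintegralZl// -/q.
apply: normr_Rintegral_dominated.
- have [/measurable_EFinP m1 _] := integrableP _ _ _ iAL.
  have [/measurable_EFinP m2 _] := integrableP _ _ _ iAD.
  exact: measurable_funB.
- exact: integrableZl_EFin.
- move=> x; rewrite -mulrBr normrM.
  apply: (@le_trans _ _ (CA * (CB * C0 * t ^+ 2 * q * Q x))).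
    by rewrite ler_pM.
  by rewrite !mulrA.
Qed.

End corr_expansion.

(** * The derivative of the noise correlation *)

(** A quadratic error is all that [corr_expansion] gives, and it is enough for
    a derivative. *)
Lemma is_derive_quadratic {R : realType} (F : R -> R) (a l C d : R) : 0 < d ->
  (forall h, `|h| <= d -> `|F (a + h) - F a - h * l| <= C * h ^+ 2) ->
  is_derive a 1 F l.
Proof.
move=> d0 H.
have cv : h^-1 *: (F (h *: (1 : R) + a) - F a) @[h --> 0^'] --> l.
  apply/cvgrPdist_le => e e0; near=> h.
  have h0 : h != 0 by near: h; exact: nbhs_dnbhs_neq.
  have hd : `|h| <= d.
    near: h; apply: dnbhs0_le => //.
  have he : `|h| <= e / (`|C| + 1).
    by near: h; apply: dnbhs0_le; rewrite divr_gt0// ltr_wpDl.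
  rewrite scaler1 distrC addrC [h + a]addrC.
  rewrite (_ : _ + _ = h^-1 * (F (a + h) - F a - h * l)); last first.
    by rewrite /GRing.scale/=; field.
  rewrite normrM normfV ler_pdivrMl ?normr_gt0//.
  rewrite (le_trans (H _ hd))// -sqr_normr expr2.
  have hC : (`|C| + 1) * `|h| <= e.
    by rewrite mulrC -ler_pdivlMr// ltr_wpDl.
  have hn := normr_ge0 h; have Cn := normr_ge0 C; have Cl := ler_norm C.
  rewrite mulrA mulrC ler_wpM2l//.
  by rewrite (le_trans _ hC)// ler_wpM2r//; lra.
by apply: DeriveDef; [apply: cvgP cv|apply: cvg_lim cv].
Unshelve. all: by end_near. Qed.

Section iterated.
Context {R : realType} d (S : measurableType d) (P : probability S R).
Implicit Types h g : S * S -> R.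

Lemma bmeas_slice h x : bmeas h -> bmeas (fun y => h (x, y)).
Proof. by move=> bh; apply: bmeas_comp bh. Qed.

Lemma Rintegral2D h g : bmeas h -> bmeas g ->
  \int[P]_x \int[P]_y (h (x, y) + g (x, y)) =
  \int[P]_x \int[P]_y h (x, y) + \int[P]_x \int[P]_y g (x, y).
Proof.
move=> bh bg; rewrite -RintegralD_bmeas; last 2 first.
- exact: bmeas_Rintegral.
- exact: bmeas_Rintegral.
apply: eq_Rintegral => x _; rewrite RintegralD_bmeas//; exact: bmeas_slice.
Qed.

Lemma Rintegral2Z c h : bmeas h ->
  \int[P]_x \int[P]_y (c * h (x, y)) = c * \int[P]_x \int[P]_y h (x, y).
Proof.
move=> bh; rewrite -RintegralZ_bmeas; last exact: bmeas_Rintegral.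
apply: eq_Rintegral => x _; rewrite RintegralZ_bmeas//; exact: bmeas_slice.
Qed.

Lemma bmeas_lin h g k c : bmeas h -> bmeas g -> bmeas k ->
  bmeas (fun p => h p - (g p + c * k p)).
Proof.
move=> bh bg bk; have := bmeasD bh (bmeasZ (-1) (bmeasD bg (bmeasZ c bk))).
by under eq_fun do rewrite mulN1r.
Qed.

Lemma Rintegral2_lin h g k c : bmeas h -> bmeas g -> bmeas k ->
  \int[P]_x \int[P]_y (h (x, y) - (g (x, y) + c * k (x, y))) =
  \int[P]_x \int[P]_y h (x, y) -
  (\int[P]_x \int[P]_y g (x, y) + c * \int[P]_x \int[P]_y k (x, y)).
Proof.
move=> bh bg bk; have bck := bmeasZ c bk; have bgk := bmeasD bg bck.
have bN := bmeasZ (-1) bgk.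
have := Rintegral2D bh bN; rewrite (Rintegral2Z (-1) bgk) mulN1r.
rewrite (Rintegral2D bg bck) (Rintegral2Z c bk) => <-.
by apply: eq_Rintegral => x _; apply: eq_Rintegral => y _; rewrite mulN1r.
Qed.

Lemma bmeas_lin3 h g k a b c : bmeas h -> bmeas g -> bmeas k ->
  bmeas (fun p => a * h p + b * g p + c * k p).
Proof.
move=> bh bg bk.
by apply: bmeasD; [apply: bmeasD; exact: bmeasZ|exact: bmeasZ].
Qed.

Lemma Rintegral2_lin3 h g k a b c : bmeas h -> bmeas g -> bmeas k ->
  \int[P]_x \int[P]_y (a * h (x, y) + b * g (x, y) + c * k (x, y)) =
  a * \int[P]_x \int[P]_y h (x, y) + b * \int[P]_x \int[P]_y g (x, y) +
  c * \int[P]_x \int[P]_y k (x, y).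
Proof.
move=> bh bg bk.
have bhg := bmeasD (bmeasZ a bh) (bmeasZ b bg).
rewrite (Rintegral2D bhg (bmeasZ c bk)) (Rintegral2Z c bk); congr (_ + _).
by rewrite (Rintegral2D (bmeasZ a bh) (bmeasZ b bg)) !Rintegral2Z.
Qed.

Lemma le_Rintegral2 h g : bmeas h -> bmeas g -> (forall p, h p <= g p) ->
  \int[P]_x \int[P]_y h (x, y) <= \int[P]_x \int[P]_y g (x, y).
Proof.
move=> bh bg hg; apply: le_Rintegral_bmeas; [exact: bmeas_Rintegral..|move=> x].
by apply: le_Rintegral_bmeas; [exact: bmeas_slice..|move=> y].
Qed.

Lemma normr_Rintegral2_le h C : bmeas h -> (forall p, `|h p| <= C) ->
  `|\int[P]_x \int[P]_y h (x, y)| <= C.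
Proof.
move=> bh hC; apply: normr_Rintegral_le => [|x]; first exact: bmeas_Rintegral.
by apply: normr_Rintegral_le => //; exact: bmeas_slice.
Qed.

Lemma Rintegral2_sum (I : Type) (r : seq I) (h : I -> S * S -> R) :
  (forall i, bmeas (h i)) ->
  \int[P]_x \int[P]_y (\sum_(i <- r) h i (x, y)) =
  \sum_(i <- r) \int[P]_x \int[P]_y h i (x, y).
Proof.
move=> bh; rewrite -Rintegral_sum; last first.
  by move=> i; apply: bmeas_integrable; exact: bmeas_Rintegral.
apply: eq_Rintegral => x _; rewrite Rintegral_sum// => i.
by apply: bmeas_integrable; exact: bmeas_slice.
Qed.

End iterated.

Section derive_corr.
Context {R : realType}.
Notation V n := (n.-tuple (measurableTypeR R)).
Notation gam := (@std_gaussian R).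
Implicit Types (n : nat).

Lemma Rintegral_gauss_coord_le n (j : 'I_n) (A : V n -> R) C : bmeas A ->
  (forall x, `|A x| <= C) -> `|\int[gam n]_z (A z * tnth z j)| <= C.
Proof.
move=> bA AC.
have C0 : 0 <= C by rewrite (le_trans _ (AC [tuple 0 | i < n]))// normr_ge0.
have ij := integrable_norm (integrable_gauss_coord (R := R) j).
apply: (@le_trans _ _ (\int[gam n]_z (C * `|tnth z j|))).
  apply: normr_Rintegral_dominated.
  - by apply: measurable_funM; [case: bA|exact: measurable_tnth].
  - exact: integrableZl_EFin.
  - by move=> z; rewrite normrM ler_wpM2r.
rewrite RintegralZl//; apply: ler_piMr => //.
have := gauss_coord_abs_le1 (R := R) j.
by rewrite EFin_Rintegral.
Qed.

Lemma normr_ou_grad_le n r (j : 'I_n) (u : V n -> R) C x : bmeas u ->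
  (forall x, `|u x| <= C) -> `|ou_grad r j u x| <= (cosine r)^-1 * C.
Proof.
move=> bu uC; have c0 : 0 <= (cosine r)^-1 by rewrite invr_ge0 sqrtr_ge0.
rewrite normrM ger0_norm// ler_wpM2l//.
apply: (@Rintegral_gauss_coord_le _ _ (fun z => u (lin r x (cosine r) z))) => //.
by apply: bmeas_comp bu; exact: measurable_lin.
Qed.

Lemma bmeas_ou_grad n r (j : 'I_n) (u : V n -> R) : bmeas u ->
  bmeas (ou_grad r j u).
Proof.
move=> bu; have [mu [C uC]] := bu; split; last first.
  by exists ((cosine r)^-1 * C) => x; exact: normr_ou_grad_le.
apply: measurable_funM => //.
apply: (@measurable_Rintegral _ _ _ _ _ _
  (fun p => u (lin r p.1 (cosine r) p.2) * tnth p.2 j)).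
apply: measurable_funM; last exact: measurable_tnth_comp.
by apply: (measurableT_comp mu); exact: measurable_lin.
Qed.

(** By [corr_add], corr f g (r^2 s + h) is an average of correlations at level
    h / (1 - r^2) of the functions z |-> f(r x + cosine r z) and
    w |-> g(r x' + cosine r w), for s-correlated x and x'. Their first-order
    expansions have uniform quadratic errors, and the first-order coefficients
    are the products of averaged gradients at x and x'. Formally the sum is
    that of the correlations of d_j f and d_j g at level r^2 s. *)
Lemma is_derive_corr n (r s : R) (f g : V n -> R) :
  0 < r < 1 -> -1 < s < 1 ->
  bmeas f -> bmeas g -> (forall x, 0 <= f x) -> (forall x, 0 <= g x) ->
  is_derive (r ^+ 2 * s) 1 (corr f g)
    (\sum_(j < n) corr (ou_grad r j f) (ou_grad r j g) s).
Proof.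
move=> r01 s1 bf bg f0 g0.
have r11 : -1 < r < 1 by case/andP: r01 => r0 ->; rewrite andbT (lt_trans _ r0)// ltrN10.
have c0 : 0 < cosine r := cosine_gt0 r11.
set r' := cosine r in c0 *.
have r2 : 0 < r' ^+ 2 by rewrite exprn_gt0.
have r28 : 0 < r' ^+ 2 / 8 by rewrite divr_gt0.
have scale (h : R) : `|h| <= r' ^+ 2 / 8 -> `|h / r' ^+ 2| <= 1 / 8.
  by rewrite normrM normfV (ger0_norm (ltW r2)) ler_pdivrMr// mul1r mulrC.
have small (t : R) : `|t| <= 1 / 8 -> -1 < t < 1.
  by move=> t8; rewrite -ltr_norml; apply: (le_lt_trans t8); lra.
have divK (h : R) : h = r' ^+ 2 * (h / r' ^+ 2).
  by rewrite mulrC divfK// gt_eqF.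
have [K [K0 HK]] := @corr_expansion R n.
have [_ [Cf hf]] := bf; have [_ [Cg hg]] := bg.
pose A x z := f (lin r x r' z).
pose B x y w := g (lin r (lin s x (cosine s) y) r' w).
have bA x : bmeas (A x) by apply: bmeas_comp bf; exact: measurable_lin.
have bB x y : bmeas (B x y) by apply: bmeas_comp bg; exact: measurable_lin.
pose ps t (p : V n * V n) := corr (A p.1) (B p.1 p.2) t.
pose ph0 (p : V n * V n) := ou r f p.1 * ou r g (lin s p.1 (cosine s) p.2).
pose ph1 (p : V n * V n) := \sum_(j < n)
   ou_grad r j f p.1 * ou_grad r j g (lin s p.1 (cosine s) p.2).
have bpair (u v : V n -> R) : bmeas u -> bmeas v ->
    bmeas (fun p : V n * V n => u p.1 * v (lin s p.1 (cosine s) p.2)).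
  move=> bu bv; apply: bmeasM; first exact: bmeas_comp bu.
  by apply: bmeas_comp bv; exact: measurable_lin.
have bph0 : bmeas ph0 by apply: bpair; exact: bmeas_ou.
have bph1 : bmeas ph1.
  by apply: bmeas_sum => j; apply: bpair; exact: bmeas_ou_grad.
have bps t : bmeas (ps t).
  pose D (p : V n * V n * V n * V n) := f (lin r p.1.1.1 r' p.1.2) *
    g (lin r (lin s p.1.1.1 (cosine s) p.1.1.2) r' (lin t p.1.2 (cosine t) p.2)).
  have bD : bmeas D.
    apply: bmeasM; [apply: bmeas_comp bf|apply: bmeas_comp bg].
      by apply: measurable_lin; [exact: measurable_proj4_1|exact: measurable_proj4_3].
    apply: measurable_lin; apply: measurable_lin.
    - exact: measurable_proj4_1.
    - exact: measurable_proj4_2.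
    - exact: measurable_proj4_3.
    - exact: measurable_proj4_4.
  apply: (@bmeas_Rintegral _ _ _ _ _ _ (fun p : V n * V n * V n =>
    \int[gam n]_w D (p.1.1, p.1.2, p.2, w))).
  apply: (@bmeas_Rintegral _ _ _ _ _ _ (fun p : V n * V n * V n * V n =>
    D (p.1.1.1, p.1.1.2, p.1.2, p.2))).
  by rewrite (_ : (fun p => _) = D).
have eps t : -1 < t < 1 -> corr f g (r ^+ 2 * s + r' ^+ 2 * t) =
    \int[gam n]_x \int[gam n]_y ps t (x, y).
  by move=> t1; exact: corr_add.
have e0 : corr f g (r ^+ 2 * s) = \int[gam n]_x \int[gam n]_y ph0 (x, y).
  by rewrite -(@corr_ou _ n r s f g).
have e1 : \sum_(j < n) corr (ou_grad r j f) (ou_grad r j g) s =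
    \int[gam n]_x \int[gam n]_y ph1 (x, y).
  apply: esym; apply: (@Rintegral2_sum _ _ _ _ _ _ (fun j (p : V n * V n) =>
    ou_grad r j f p.1 * ou_grad r j g (lin s p.1 (cosine s) p.2))) => j.
  by apply: bpair; exact: bmeas_ou_grad.
rewrite e1; set l := \int[gam n]_x _.
apply: (@is_derive_quadratic _ _ _ _ (Cf * Cg * K / r' ^+ 4) _ r28) => h hd.
pose t := h / r' ^+ 2.
have t8 : `|t| <= 1 / 8 := scale h hd.
have eh : h = r' ^+ 2 * t := divK h.
rewrite {1}eh (eps t (small t t8)) e0.
rewrite -addrA -opprD -(Rintegral2_lin (gam n) h (bps t) bph0 bph1).
apply: (normr_Rintegral2_le (gam n) (bmeas_lin h (bps t) bph0 bph1)).
move=> [x y] /=.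
have := HK (A x) (B x y) Cf Cg t (bA x) (bB x y) (fun w => g0 _)
  (fun z => hf _) (fun w => hg _) t8.
rewrite -/(ps t (x, y)).
have -> : \sum_(j < n) (\int[gam n]_z (A x z * tnth z j)) *
    (\int[gam n]_w (B x y w * tnth w j)) = r' ^+ 2 * ph1 (x, y).
  rewrite /ph1 mulr_sumr; apply: eq_bigr => j _; rewrite /ou_grad -/r' /=.
  by field; rewrite gt_eqF.
have -> : \int[gam n]_z A x z * \int[gam n]_w B x y w = ph0 (x, y) by [].
have -> : Cf * Cg * K / r' ^+ 4 * h ^+ 2 = Cf * Cg * K * t ^+ 2.
  by rewrite eh; field; rewrite gt_eqF.
have -> : ph0 (x, y) + h * ph1 (x, y) =
    ph0 (x, y) + t * (r' ^+ 2 * ph1 (x, y)) by rewrite eh; ring.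
by [].
Qed.

End derive_corr.

(** * The level-one inequality *)

Section level1.
Context {R : realType}.
Notation V n := (n.-tuple (measurableTypeR R)).
Notation gam := (@std_gaussian R).
Implicit Types (n : nat).

Lemma gauss_mgf n (l : 'I_n -> R) :
  (\int[gam n]_x (expR (\sum_(j < n) l j * tnth x j))%:E =
   (expR ((\sum_(j < n) l j ^+ 2) / 2))%:E)%E.
Proof.
transitivity (\int[gam n]_x (\prod_(j < n) expR (l j * tnth x j))%:E)%E.
  by apply: eq_integral => x _; rewrite expR_sum.
rewrite (@integral_gauss_prod _ _ (fun j x => expR (l j * x))); last 2 first.
- by move=> i; apply: measurableT_comp => //; apply: measurable_funM.
- by move=> i x; exact: expR_ge0.
under eq_bigr do rewrite gauss1_mgf.
by rewrite prodEFin -expR_sum -mulr_suml.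
Qed.

(** The Gibbs variational principle, pointwise: a (1 + y) <= M exp y for
    0 <= a <= M, with y = t - |l|^2 / 2 - ln k and t = l . x; the shift
    |l|^2 / 2 normalizes the Gaussian mean of exp t. *)
Lemma level1_linear n (A : V n -> R) (M k : R) (l : 'I_n -> R) :
  bmeas A -> (forall x, 0 <= A x <= M) -> 0 < k ->
  \sum_(j < n) l j * \int[gam n]_x (A x * tnth x j) <=
  M / k + \int[gam n]_x A x * (ln k - 1 + (\sum_(j < n) l j ^+ 2) / 2).
Proof.
move=> bA AM k0; set s := \sum_(j < n) l j ^+ 2.
have iA : (gam n).-integrable setT (EFin \o A) := bmeas_integrable _ bA.
have iAj j : (gam n).-integrable setT (EFin \o (fun y => A y * tnth y j)).
  by apply: integrable_bmeasM => //; exact: integrable_gauss_coord.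
have iE : (gam n).-integrable setT
    (EFin \o (fun x => expR (\sum_(j < n) l j * tnth x j))).
  apply/integrableP; split.
    apply/measurable_EFinP; apply: measurableT_comp => //.
    apply: measurable_sum => i; apply: measurable_funM => //.
    exact: measurable_tnth.
  under eq_integral do rewrite /= ger0_norm ?expR_ge0//.
  by rewrite gauss_mgf ltry.
set c := ln k - 1 + s / 2.
have -> : \sum_(j < n) l j * \int[gam n]_x (A x * tnth x j) =
    \int[gam n]_x (\sum_(j < n) l j * (A x * tnth x j)).
  rewrite Rintegral_sum; last by move=> j; exact: integrableZl_EFin.
  by apply: eq_bigr => j _; rewrite RintegralZl.
have -> : M / k + \int[gam n]_x A x * c = \int[gam n]_x
    (M / k * expR (- (s / 2)) * expR (\sum_(j < n) l j * tnth x j) + c * A x).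
  rewrite RintegralD//; [|exact: integrableZl_EFin..].
  rewrite !RintegralZl// [c * _]mulrC; congr (_ + _).
  rewrite /Rintegral gauss_mgf /= -/s -mulrA -expRD addNr expR0 mulr1.
  by [].
apply: le_Rintegral => //.
- by apply: integrable_sum_EFin => j; exact: integrableZl_EFin.
- by apply: integrableD_EFin; exact: integrableZl_EFin.
move=> x _; have /andP[A0 AMx] := AM x.
set t := \sum_(j < n) l j * tnth x j.
have -> : \sum_(j < n) l j * (A x * tnth x j) = A x * t.
  by rewrite /t mulr_sumr; apply: eq_bigr => j _; rewrite mulrCA.
have h := expR_ge1Dx (t - s / 2 - ln k).
have e : expR (t - s / 2 - ln k) = expR (- (s / 2)) * expR t / k.
  by rewrite !expRD (expRN (ln k)) lnK ?posrE// [_ * expR t]mulrC.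
rewrite e in h.
have g : A x * (1 + (t - s / 2 - ln k)) <= M * (expR (- (s / 2)) * expR t / k).
  apply: (@le_trans _ _ (A x * (expR (- (s / 2)) * expR t / k))).
    by rewrite ler_wpM2l.
  by rewrite ler_wpM2r// !mulr_ge0 ?expR_ge0// invr_ge0 ltW.
have -> : M / k * expR (- (s / 2)) * expR t = M * (expR (- (s / 2)) * expR t / k).
  by ring.
by rewrite /c; lra.
Qed.

(** The linear inequality in the direction of the moment vector m itself, with
    length optimized to m / U. The parameter k, instead of its optimal value
    M / U, leaves a factor M / k + U (ln k - 1) that is affine in U, which
    matters when U is itself a random quantity. *)
Lemma level1 n (A : V n -> R) (M k : R) :
  bmeas A -> (forall x, 0 <= A x <= M) -> 0 < k ->
  let U := \int[gam n]_x A x in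
  0 <= M / k + U * (ln k - 1) /\
  \sum_(j < n) (\int[gam n]_x (A x * tnth x j)) ^+ 2 <=
    2 * U * (M / k + U * (ln k - 1)).
Proof.
move=> bA AM k0 U; have U0 : 0 <= U.
  by apply: Rintegral_ge0 => x _; have /andP[] := AM x.
pose m j := \int[gam n]_x (A x * tnth x j).
set q := \sum_(j < n) _.
have q0 : 0 <= q by apply: sumr_ge0 => j _; exact: sqr_ge0.
split.
  have := level1_linear (fun=> 0) bA AM k0.
  rewrite big1 ?big1 => [|j _|j _]; rewrite ?expr0n ?mul0r//.
  by rewrite addr0.
have lin k' c : 0 < k' -> c * q <= M / k' + U * (ln k' - 1 + c ^+ 2 * q / 2).
  move=> k'0; have := level1_linear (fun j => c * m j) bA AM k'0.
  rewrite -/U; congr (_ <= _ + _ * (_ + _ / _)).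
    by rewrite /q mulr_sumr; apply: eq_bigr => j _; rewrite -mulrA -expr2.
  by rewrite /q mulr_sumr; apply: eq_bigr => j _; rewrite exprMn.
have [U00|Upos] := eqVneq U 0.
  rewrite U00 mulr0 mul0r leNgt; apply/negP => qpos.
  have M0 : 0 <= M by case/andP: (AM [tuple 0 | i < n]) => /le_trans; apply.
  (* A mean zero forces q = 0: otherwise k = 2 (M + 1) / q, in direction m,
     gives q <= M q / (2 (M + 1)) < q. *)
  have k'0 : 0 < 2 * (M + 1) / q by rewrite divr_gt0// mulr_gt0// ltr_wpDl.
  have := lin _ 1 k'0; rewrite U00 mul0r addr0 mul1r invf_div mulrA.
  rewrite ler_pdivlMr ?mulr_gt0 ?ltr_wpDl//.
  by nra.
have {}U0 : 0 < U by rewrite lt_neqAle eq_sym Upos.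
have := lin k U^-1 k0.
rewrite (_ : M / k + U * (ln k - 1 + U^-1 ^+ 2 * q / 2) =
  M / k + U * (ln k - 1) + U^-1 * q / 2); last by field; rewrite !gt_eqF.
set x := M / k + U * (ln k - 1) => h.
have : U^-1 * q <= 2 * x by lra.
by rewrite mulrC ler_pdivrMr//; lra.
Qed.

Lemma cauchy_schwarz_sum n (p q : 'I_n -> R) :
  (\sum_(j < n) p j * q j) ^+ 2 <= (\sum_(j < n) p j ^+ 2) * \sum_(j < n) q j ^+ 2.
Proof.
set x := \sum_(j < n) p j * q j; set a := \sum_(j < n) p j ^+ 2.
set b := \sum_(j < n) q j ^+ 2.
have a0 : 0 <= a by apply: sumr_ge0 => j _; exact: sqr_ge0.
have H (t : R) : 0 <= t ^+ 2 * a + 2 * t * x + b.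
  rewrite /a /x /b !mulr_sumr -!big_split/=; apply: sumr_ge0 => j _.
  by rewrite (_ : _ + _ = (t * p j + q j) ^+ 2) ?sqr_ge0//; ring.
have [a00|an0] := eqVneq a 0.
  have b0 : 0 <= b by apply: sumr_ge0 => j _; exact: sqr_ge0.
  have [->|x0] := eqVneq x 0; first by rewrite expr0n/= mulr_ge0.
  have := H (- ((b + 1) / x)); rewrite a00 mulr0 add0r.
  rewrite (_ : 2 * - ((b + 1) / x) * x = - (2 * (b + 1))); first lra.
  by field.
have ap : 0 < a by rewrite lt_neqAle eq_sym an0.
have := H (- x / a).
rewrite (_ : _ + b = (b * a - x ^+ 2) / a); last by field; rewrite gt_eqF.
by rewrite pmulr_lge0 ?invr_gt0// subr_ge0 mulrC.
Qed.

End level1.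

(** * The correlation decreases slowly *)

Lemma is_derive_ge0_le {R : realType} (F dF : R -> R) (a b : R) : a <= b ->
  (forall x, a <= x <= b -> is_derive x 1 F (dF x)) ->
  (forall x, a <= x <= b -> 0 <= dF x) -> F a <= F b.
Proof.
move=> ab dFF dF0.
have sub x : x \in `]a, b[ -> a <= x <= b.
  by rewrite in_itv/= => /andP[/ltW -> /ltW ->].
apply: (@ger0_derive1_ndecr _ F a b) => //.
- move=> x /sub xab; exact: (@ex_derive _ _ _ _ _ _ _ (dFF _ xab)).
- move=> x /sub xab; have d := dFF _ xab.
  by rewrite derive1E (@derive_val _ _ _ _ _ _ _ d) dF0.
- apply: derivable_within_continuous => x; rewrite in_itv/= => xab.
  exact: (@ex_derive _ _ _ _ _ _ _ (dFF _ xab)).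
Qed.

(** From |S| <= 4 sqrt (U a W b) by the weighted arithmetic-geometric mean
    inequality. The factors are grouped as W a and U b: when a is affine in U
    and b is affine in W, these are affine in U, W and U W, whose integrals
    are the two means and the correlation. *)
Lemma cross_term_ge {R : realType} (S P Q U W a b l : R) :
  S ^+ 2 <= P * Q -> 0 <= P -> 0 <= Q ->
  P <= 4 * U * a -> Q <= 4 * W * b -> 0 <= U -> 0 <= W -> 0 <= a -> 0 <= b ->
  0 < l -> - 2 * (l * (W * a) + l^-1 * (U * b)) <= S.
Proof.
move=> SPQ P0 Q0 Pa Qb U0 W0 a0 b0 l0.
set x := l * (W * a); set y := l^-1 * (U * b).
have x0 : 0 <= x by rewrite mulr_ge0 ?mulr_ge0// ltW.
have y0 : 0 <= y by rewrite mulr_ge0 ?mulr_ge0// invr_ge0 ltW.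
have xy : x * y = (U * a) * (W * b).
  by rewrite /x /y; field; rewrite gt_eqF.
have PQ : P * Q <= (4 * U * a) * (4 * W * b) by rewrite ler_pM.
have : S ^+ 2 <= (2 * (x + y)) ^+ 2.
  rewrite (le_trans SPQ)// (le_trans PQ)//.
  have := sqr_ge0 (x - y).
  rewrite (_ : 4 * U * a * (4 * W * b) = 16 * (x * y)); last by rewrite xy; ring.
  rewrite !expr2 => h; lra.
move=> h; have : `|S| <= 2 * (x + y).
  by rewrite -(@ler_pXn2r _ 2)// ?nnegrE// ?mulr_ge0 ?addr_ge0// sqr_normr.
by rewrite ler_norml => /andP[+ _]; lra.
Qed.

Section slow_decrease.
Context {R : realType}.
Notation V n := (n.-tuple (measurableTypeR R)).
Notation gam := (@std_gaussian R).
Implicit Types (n : nat).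

(** With r^2 = 1/2 the averaging weight r and the noise weight cosine r
    coincide. *)
Definition rhalf : R := Num.sqrt (1 / 2).

Lemma sqr_rhalf : rhalf ^+ 2 = 1 / 2.
Proof. by rewrite sqr_sqrtr//; lra. Qed.

Lemma cosine_rhalf : cosine rhalf = rhalf.
Proof. by rewrite /cosine sqr_rhalf /rhalf; congr Num.sqrt; lra. Qed.

Lemma rhalf_itv : 0 < rhalf < 1.
Proof.
have r0 : 0 < rhalf by rewrite sqrtr_gt0; lra.
by rewrite r0; have := sqr_rhalf; nra.
Qed.

(** The level-one inequality for z |-> u(r x + cosine r z), with M = 2. At
    r^2 = 1/2 the factor (cosine r)^-2 is 2. *)
Lemma ou_grad_half_sum n (u : V n -> R) (k : R) x :
  bmeas u -> (forall x, 0 <= u x <= 2) -> 0 < k ->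
  let U := ou rhalf u x in
  0 <= 2 / k + U * (ln k - 1) /\
  \sum_(j < n) ou_grad rhalf j u x ^+ 2 <= 4 * U * (2 / k + U * (ln k - 1)).
Proof.
move=> bu u2 k0 U.
have bA : bmeas (fun z => u (lin rhalf x (cosine rhalf) z)).
  by apply: bmeas_comp bu; exact: measurable_lin.
have [h1 h2] := level1 bA (fun z => u2 _) k0; split => //.
have -> : \sum_(j < n) ou_grad rhalf j u x ^+ 2 = 2 *
    \sum_(j < n) (\int[gam n]_z (u (lin rhalf x (cosine rhalf) z) * tnth z j)) ^+ 2.
  rewrite mulr_sumr; apply: eq_bigr => j _; rewrite exprMn exprVn.
  by rewrite cosine_rhalf sqr_rhalf; congr (_ * _); field.
have := h2; rewrite -/(ou rhalf u x) -/U; lra.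
Qed.

(** The sum is the derivative of corr u v at t / 2. At correlated points x and
    y, Cauchy-Schwarz and the level-one inequality bound the sum of products of
    averaged gradients by the averages U of u at x and W of v at y; then one
    integrates, since E U = E u, E W = E v and E (U W) = corr u v (t / 2). The
    parameters k1, k2, l are constants, to be chosen from the means. *)
Lemma corr_derive_ge n (u v : V n -> R) (k1 k2 l t : R) :
  bmeas u -> bmeas v -> (forall x, 0 <= u x <= 2) -> (forall x, 0 <= v x <= 2) ->
  0 < k1 -> 0 < k2 -> 0 < l -> -1 < t < 1 ->
  - 2 * (l * (2 / k1 * (\int[gam n]_x v x) +
              (ln k1 - 1) * corr u v (1 / 2 * t)) +
         l^-1 * (2 / k2 * (\int[gam n]_x u x) +
              (ln k2 - 1) * corr u v (1 / 2 * t))) <=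
  \sum_(j < n) corr (ou_grad rhalf j u) (ou_grad rhalf j v) t.
Proof.
move=> bu bv u2 v2 k10 k20 l0 t1; set N := corr u v _.
have u0 x : 0 <= u x by have /andP[] := u2 x.
have v0 x : 0 <= v x by have /andP[] := v2 x.
set r := rhalf; have r01 : 0 < r < 1 := rhalf_itv.
have r0 : 0 < r by case/andP: r01.
pose W x y := ou r v (lin t x (cosine t) y).
have bou : bmeas (ou r u) by exact: bmeas_ou.
have bov : bmeas (ou r v) by exact: bmeas_ou.
have bpair (f g : V n -> R) : bmeas f -> bmeas g ->
    bmeas (fun p : V n * V n => f p.1 * g (lin t p.1 (cosine t) p.2)).
  move=> bf bg; apply: bmeasM; first exact: bmeas_comp bf.
  by apply: bmeas_comp bg; exact: measurable_lin.
have NE : N = \int[gam n]_x \int[gam n]_y (ou r u x * W x y).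
  by rewrite /N -sqr_rhalf -corr_ou.
have rr : r ^+ 2 + r ^+ 2 = 1 by rewrite sqr_rhalf; lra.
have mean (f : V n -> R) : bmeas f -> (forall x, 0 <= f x) ->
    \int[gam n]_x ou r f x = \int[gam n]_x f x.
  move=> bf f0.
  transitivity (\int[gam n]_x \int[gam n]_y f (lin r x r y)).
    by apply: eq_Rintegral => x _; rewrite /ou cosine_rhalf.
  exact: Rintegral_gauss_conv.
have EW : \int[gam n]_x \int[gam n]_y W x y = \int[gam n]_x v x.
  transitivity (\int[gam n]_x ou r v x); last exact: mean.
  apply: (Rintegral_gauss_conv (cosine_gt0 t1) (cosineP t1) bov) => x.
  by apply: Rintegral_ge0.
have EU : \int[gam n]_x \int[gam n]_y ou r u x = \int[gam n]_x u x.
  rewrite -(mean u bu u0); apply: eq_Rintegral => x _.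
  exact: Rintegral_cst_prob.
pose c1 := -2 * (l * (2 / k1)); pose c2 := -2 * (l^-1 * (2 / k2)).
pose c3 := -2 * (l * (ln k1 - 1) + l^-1 * (ln k2 - 1)).
pose pW (p : V n * V n) := W p.1 p.2.
pose pU (p : V n * V n) := ou r u p.1.
pose pUW (p : V n * V n) := ou r u p.1 * W p.1 p.2.
have bW : bmeas pW by apply: bmeas_comp bov; exact: measurable_lin.
have bU : bmeas pU by apply: bmeas_comp bou.
have bUW : bmeas pUW by apply: bpair.
have -> : - 2 * (l * (2 / k1 * (\int[gam n]_x v x) + (ln k1 - 1) * N) +
         l^-1 * (2 / k2 * (\int[gam n]_x u x) + (ln k2 - 1) * N)) =
    \int[gam n]_x \int[gam n]_y ((c1 * pW (x, y) + c2 * pU (x, y)) + c3 * pUW (x, y)).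
  rewrite (Rintegral2_lin3 (gam n) c1 c2 c3 bW bU bUW) EW EU -NE.
  by rewrite /c1 /c2 /c3; ring.
pose g j (p : V n * V n) :=
  ou_grad r j u p.1 * ou_grad r j v (lin t p.1 (cosine t) p.2).
have bg j : bmeas (g j) by apply: bpair; exact: bmeas_ou_grad.
have -> : \sum_(j < n) corr (ou_grad r j u) (ou_grad r j v) t =
    \int[gam n]_x \int[gam n]_y (\sum_(j < n) g j (x, y)).
  by apply: esym; apply: (Rintegral2_sum (gam n)).
apply: (@le_Rintegral2 _ _ _ (gam n)
  (fun p => (c1 * pW p + c2 * pU p) + c3 * pUW p)
  (fun p => \sum_(j < n) g j p)).
- exact: (bmeas_lin3 c1 c2 c3 bW bU bUW).
- exact: bmeas_sum.
move=> [x y]; rewrite /pW /pU /pUW /=.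
have [a0 ha] := ou_grad_half_sum x bu u2 k10.
have [b0 hb] := ou_grad_half_sum (lin t x (cosine t) y) bv v2 k20.
have Ux0 : 0 <= ou r u x by apply: Rintegral_ge0.
have Wx0 : 0 <= W x y by apply: Rintegral_ge0.
have := cross_term_ge (cauchy_schwarz_sum (fun j => ou_grad r j u x)
  (fun j => ou_grad r j v (lin t x (cosine t) y))) _ _ ha hb Ux0 Wx0 a0 b0 l0.
rewrite -/r -/(W x y) => h; apply: le_trans (h _ _); last 2 first.
- by apply: sumr_ge0 => j _; exact: sqr_ge0.
- by apply: sumr_ge0 => j _; exact: sqr_ge0.
by rewrite le_eqVlt; apply/orP; left; apply/eqP; rewrite /c1 /c2 /c3; ring.
Qed.

Definition logterm (a : R) : R := ln (expR 1 / a).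

Lemma logterm_ge1 a : 0 < a <= 1 -> 1 <= logterm a.
Proof.
move=> /andP[a0 a1]; rewrite /logterm -[leLHS]expRK.
by rewrite ler_ln ?posrE ?divr_gt0 ?expR_gt0// ler_pdivlMr// ler_piMr ?expR_ge0.
Qed.

(** (F + c) exp (K t) is nondecreasing, so F s >= 2 c exp (- K s) - c. *)
Lemma gronwall_lower_bound (F dF : R -> R) (c K s : R) : 0 <= c -> 0 <= s ->
  (forall t : R, 0 <= t <= s -> is_derive t 1 F (dF t)) ->
  (forall t, 0 <= t <= s -> - K * (F t + c) <= dF t) -> F 0 = c ->
  c * (1 - 2 * K * s) <= F s.
Proof.
move=> c0 s0 FdF dFge F0.
pose G t := (F t + c) * expR (K * t).
have GE (t : R) : 0 <= t <= s -> is_derive t 1 G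
    (dF t * expR (K * t) + (F t + c) * (K * expR (K * t))).
  move=> ts; have d1 := FdF t ts.
  have d2 : is_derive t 1 (fun t : R => K * t) K.
    by apply: is_derive_eq; rewrite /GRing.scale /= mulr1.
  have d3 := @is_derive1_comp _ expR (fun t : R => K * t) t _ _
    (is_derive_expR (K * t)) d2.
  have d4 : is_derive t 1 (fun t : R => F t + c) (dF t).
    by apply: is_derive_eq; rewrite addr0.
  have -> : G = (fun t : R => F t + c) * (expR \o (fun t : R => K * t)).
    by apply/funext.
  apply: is_derive_eq; rewrite /GRing.scale /=; ring.
have : G 0 <= G s.
  apply: (is_derive_ge0_le s0 GE) => t ts.
  rewrite mulrA -mulrDl mulr_ge0 ?expR_ge0//.
  by have := dFge t ts; lra.
rewrite /G F0 mulr0 expR0 mulr1 => h.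
have e0 := expR_gt0 (K * s).
have h2 : (c + c) * expR (- (K * s)) <= F s + c.
  by rewrite expRN ler_pdivrMr.
have h3 := expR_ge1Dx (- (K * s)).
have h4 : (c + c) * (1 - K * s) <= (c + c) * expR (- (K * s)).
  by rewrite ler_wpM2l//; lra.
lra.
Qed.

(** The choice of parameters in [corr_derive_ge]: k1 = e / a and k2 = e / b,
    whose logarithms are La and Lb, and the weight l = S / La that balances
    l La and Lb / l, both equal to the geometric mean S. *)
Lemma log_rate_bound (e a b La Lb N S l : R) : 0 < a -> 0 < b -> 2 <= e ->
  1 <= La -> 1 <= Lb -> 0 <= N -> S = Num.sqrt (La * Lb) -> l = S / La ->
  - (4 * S) * (N + a * b) <=
  - 2 * (l * (2 / (e / a) * b + (La - 1) * N) +
         l^-1 * (2 / (e / b) * a + (Lb - 1) * N)).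
Proof.
move=> a0 b0 e2 La1 Lb1 N0 SE lE.
have La0 : 0 < La by lra.
have Lb0 : 0 < Lb by lra.
have S0 : 0 < S by rewrite SE sqrtr_gt0 mulr_gt0.
have S2 : S ^+ 2 = La * Lb by rewrite SE sqr_sqrtr// mulr_ge0// ltW.
have l0 : 0 < l by rewrite lE divr_gt0.
have lLa : l * La = S by rewrite lE divfK// gt_eqF.
have lLb : l^-1 * Lb = S.
  by rewrite lE invf_div mulrAC -S2 expr2 mulfK// gt_eqF.
have lS : l <= S by rewrite lE ler_pdivrMr// ler_peMr// ltW.
have lS' : l^-1 <= S by rewrite -lLb ler_peMr// invr_ge0 ltW.
have li0 : 0 <= l^-1 by rewrite invr_ge0 ltW.
have ab0 : 0 < a * b by rewrite mulr_gt0.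
have ke x : 0 < x -> 2 / (e / x) <= x.
  move=> x0; rewrite ler_pdivrMr ?divr_gt0//; last by lra.
  by rewrite mulrC divfK// gt_eqF.
have h1 : 2 / (e / a) * b <= a * b by rewrite ler_wpM2r ?(ltW b0)// ke.
have h2 : 2 / (e / b) * a <= a * b by rewrite mulrC ler_wpM2l ?(ltW a0)// ke.
have g1 : l * (2 / (e / a) * b + (La - 1) * N) <= S * (a * b + N).
  apply: (@le_trans _ _ (l * (a * b + La * N))).
    by rewrite ler_wpM2l ?(ltW l0)// lerD// ler_wpM2r// lerBlDr lerDl.
  by rewrite !mulrDr (mulrA l La) lLa lerD2r ler_wpM2r ?(ltW ab0).
have g2 : l^-1 * (2 / (e / b) * a + (Lb - 1) * N) <= S * (a * b + N).
  apply: (@le_trans _ _ (l^-1 * (a * b + Lb * N))).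
    by rewrite ler_wpM2l// lerD// ler_wpM2r// lerBlDr lerDl.
  by rewrite !mulrDr (mulrA l^-1 Lb) lLb lerD2r ler_wpM2r ?(ltW ab0).
lra.
Qed.

(** For functions of means a and b at most 1, the correlation stays above a b / 2
    on an interval of length of order 1 / sqrt (log (e / a) log (e / b)). *)
Lemma corr_lower_bound n (u v : V n -> R) (s : R) :
  bmeas u -> bmeas v -> (forall x, 0 <= u x <= 2) -> (forall x, 0 <= v x <= 2) ->
  let a := \int[gam n]_x u x in let b := \int[gam n]_x v x in
  0 < a <= 1 -> 0 < b <= 1 -> 0 <= s < 1 / 2 ->
  a * b * (1 - 2 * (4 * Num.sqrt (logterm a * logterm b)) * s) <= corr u v s.
Proof.
move=> bu bv u2 v2 a b a01 b01 /andP[s0 s1].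
have [a0 a1] := andP a01; have [b0 b1] := andP b01.
have La1 := logterm_ge1 a01; have Lb1 := logterm_ge1 b01.
set S := Num.sqrt _.
have u0 x : 0 <= u x by have /andP[] := u2 x.
have v0 x : 0 <= v x by have /andP[] := v2 x.
have e2 : 2 <= expR (1 : R) by have := expR_ge1Dx (1 : R); lra.
have k0 (x : R) : 0 < x -> 0 < expR 1 / x by move=> x0; rewrite divr_gt0 ?expR_gt0.
have l0 : 0 < S / logterm a.
  have La0 : 0 < logterm a by exact: lt_le_trans La1.
  have Lb0 : 0 < logterm b by exact: lt_le_trans Lb1.
  by rewrite divr_gt0// sqrtr_gt0 mulr_gt0.
have half (t : R) : 1 / 2 * (2 * t) = t by field.
have t1 (t : R) : 0 <= t <= s -> -1 < 2 * t < 1.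
  by move=> /andP[t0 ts]; clear -t0 ts s1; apply/andP; split; lra.
apply: (@gronwall_lower_bound (corr u v) (fun t =>
    \sum_(j < n) corr (ou_grad rhalf j u) (ou_grad rhalf j v) (2 * t))) => //.
- by rewrite mulr_ge0// ltW.
- move=> t ts.
  have := is_derive_corr rhalf_itv (t1 t ts) bu bv u0 v0.
  by rewrite sqr_rhalf half.
- move=> t ts.
  apply: le_trans (corr_derive_ge bu bv u2 v2 (k0 _ a0) (k0 _ b0) l0 (t1 t ts)).
  rewrite half; apply: log_rate_bound => //.
  by apply: Rintegral_ge0 => x _; apply: Rintegral_ge0 => y _; rewrite mulr_ge0.
- exact: corr0.
Qed.

End slow_decrease.

(** * The averaged gradient and the partial derivatives *)

Section stein.
Context {R : realType}.
Notation V n := (n.-tuple (measurableTypeR R)).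
Notation gam1 := (@normal_prob R 0 1).
Notation gam := (@std_gaussian R).
Implicit Types (n : nat).

(** Relational, because tuples carry no normed structure. Continuity is asked
    along the j-th axis, where the fundamental theorem of calculus is used. *)
Definition coord_derivative n (f : V n -> R) (j : 'I_n) (df : V n -> R) :=
  forall z, (forall u : R, is_derive u 1 (fun u : R => f (upd z j u)) (df (upd z j u)))
    /\ continuous (fun u : R => df (upd z j u)).

Lemma upd_tnth n (z : V n) j u : tnth (upd z j u) j = u.
Proof. by rewrite tnth_mktuple eqxx. Qed.

(** The one-dimensional identity holds on each line parallel to the j-th axis.
    Integrating it over the lines gives, like [stein_sum], an identity between
    sums of nonnegative integrals; its known terms are finite, so they can be
    cancelled. *)
Lemma gauss_stein n (j : 'I_n) (A dA : V n -> R) (C : R) :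
  measurable_fun setT A -> measurable_fun setT dA ->
  (forall z, 0 <= dA z) -> (forall z, `|A z| <= C) -> coord_derivative A j dA ->
  (\int[gam n]_z (dA z)%:E = (\int[gam n]_z (A z * tnth z j))%:E)%E.
Proof.
move=> mA mdA dA0 AC AdA.
have C0 : 0 <= C by rewrite (le_trans _ (AC [tuple 0 | i < n]))// normr_ge0.
have mj : measurable_fun setT (fun z : V n => tnth z j) by exact: measurable_tnth.
have mabs : measurable_fun setT (fun z : V n => `|tnth z j|).
  by apply: measurableT_comp.
pose B z := C * `|tnth z j| - tnth z j * A z.
have B0 z : 0 <= B z.
  rewrite subr_ge0 (le_trans (ler_norm _))// normrM mulrC.
  by rewrite ler_wpM2r.
have mB : measurable_fun setT B.
  by apply: measurable_funB; apply: measurable_funM.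
have ij := integrable_norm (integrable_gauss_coord (R := R) j).
have iAj : (gam n).-integrable setT (EFin \o (fun y => A y * tnth y j)).
  apply: integrable_bmeasM; last exact: integrable_gauss_coord.
  by split => //; exists C.
have EB : (\int[gam n]_z (dA z)%:E + \int[gam n]_z (B z)%:E =
    (2 * C * normal_pdf 0 1 0)%:E)%E.
  have mEA : measurable_fun setT (EFin \o dA) by exact/measurable_EFinP.
  have mEB : measurable_fun setT (EFin \o B) by exact/measurable_EFinP.
  have EA0 z : (0 <= (EFin \o dA) z)%E by rewrite lee_fin.
  have EB0 z : (0 <= (EFin \o B) z)%E by rewrite lee_fin.
  rewrite (integral_gauss_resample j mEA EA0) (integral_gauss_resample j mEB EB0).
  have mup (h : V n -> R) : measurable_fun setT h -> (forall z, 0 <= h z) ->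
      measurable_fun setT (fun z => \int[gam1]_u (EFin \o h) (upd z j u))%E.
    move=> mh h0; apply: (measurable_fun_fubini_tonelli_F (m2 := gam1)
      (fun p : V n * measurableTypeR R => (h (upd p.1 j p.2))%:E)).
      apply/measurable_EFinP; apply: (measurableT_comp mh).
      exact: measurable_upd.
    by move=> p; rewrite lee_fin.
  rewrite -ge0_integralD//; last 4 first.
  - by move=> z _; apply: integral_ge0 => u _; rewrite lee_fin.
  - exact: mup.
  - by move=> z _; apply: integral_ge0 => u _; rewrite lee_fin.
  - exact: mup.
  under eq_integral => z _.
    have -> : (\int[gam1]_u (EFin \o dA) (upd z j u) +
        \int[gam1]_u (EFin \o B) (upd z j u) = (2 * C * normal_pdf 0 1 0)%:E)%E.
      have [d1 d2] := AdA z.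
      rewrite -(stein_sum d1 d2 (fun u => dA0 _) (fun u => AC _)).
      congr (_ + _)%E; apply: eq_integral => u _.
      by rewrite /= /B upd_tnth.
    over.
  by rewrite (integral_cst _ measurableT)/= probability_setT mule1.
have Eabs : \int[gam n]_z `|tnth z j| = 2 * normal_pdf 0 1 0.
  rewrite /Rintegral (@integral_gauss_resample _ n j (fun z => (`|tnth z j|)%:E))//.
    under eq_integral => z _.
      under eq_integral => u _ do rewrite upd_tnth.
      rewrite gauss1_abs_moment.
      over.
    by rewrite (integral_cst _ measurableT)/= probability_setT mule1.
  exact/measurable_EFinP.
have EBE : (\int[gam n]_z (B z)%:E =
    (2 * C * normal_pdf 0 1 0 - \int[gam n]_z (A z * tnth z j))%:E)%E.
  have eB : B = fun z => C * `|tnth z j| + -1 * (A z * tnth z j).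
    by apply/funext => z; rewrite /B; ring.
  have iC := integrableZl_EFin C ij; have iN := integrableZl_EFin (-1) iAj.
  rewrite eB EFin_Rintegral; last exact: integrableD_EFin.
  rewrite RintegralD// !RintegralZl// [\int[gam n]_x `|_|]Eabs.
  by congr EFin; ring.
move: EB; rewrite EBE; move: (\int[gam n]_z (A z * tnth z j)) (normal_pdf 0 1 0).
case: (\int[gam n]_z (dA z)%:E)%E => [r| |]// I p.
by rewrite -EFinD => -[] H; congr EFin; clear -H; lra.
Qed.

Lemma lin_upd n (a b : R) (x z : V n) j u :
  lin a x b (upd z j u) = upd (lin a x b z) j (a * tnth x j + b * u).
Proof.
apply: eq_from_tnth => i; rewrite !tnth_mktuple.
by have [->|_] := eqVneq i j.
Qed.

(** Stein's formula for z |-> f(r x + cosine r z): the averaged gradient is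
    the average of the derivative, so it is nonnegative for increasing f. *)
Lemma ou_gradE n (r : R) (j : 'I_n) (f df : V n -> R) (C : R) x :
  0 < cosine r -> measurable_fun setT f -> measurable_fun setT df ->
  (forall z, 0 <= df z) -> (forall z, `|f z| <= C) -> coord_derivative f j df ->
  (\int[gam n]_z (df (lin r x (cosine r) z))%:E = (ou_grad r j f x)%:E)%E.
Proof.
move=> c0 mf mdf df0 fC fdf; set r' := cosine r in c0 *.
have ml : measurable_fun setT (fun z : V n => lin r x r' z).
  exact: measurable_lin.
have mdfl : measurable_fun setT (fun z : V n => df (lin r x r' z)).
  exact: (measurableT_comp mdf ml).
have := @gauss_stein n j (fun z => f (lin r x r' z))
  (fun z => r' * df (lin r x r' z)) C.
have -> : (\int[gam n]_z (r' * df (lin r x r' z))%:E =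
    r'%:E * \int[gam n]_z (df (lin r x r' z))%:E)%E.
  rewrite -ge0_integralZl//.
  - exact/measurable_EFinP.
  - by move=> z _; rewrite lee_fin.
  - by rewrite lee_fin ltW.
move=> H.
have {}H : (r'%:E * \int[gam n]_z (df (lin r x r' z))%:E =
    (\int[gam n]_z (f (lin r x r' z) * tnth z j))%:E)%E.
  apply: H => [||z|z|z].
  - exact: (measurableT_comp mf ml).
  - exact: measurable_funM.
  - by rewrite mulr_ge0// ltW.
  - exact: fC.
  - have [d1 d2] := fdf (lin r x r' z); split.
    + move=> u.
      have da : is_derive u 1 (fun u : R => r * tnth x j + r' * u) r'.
        by apply: is_derive_eq; rewrite /GRing.scale /=; ring.
      have d3 := @is_derive1_comp _ (fun u : R => f (upd (lin r x r' z) j u))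
        (fun u : R => r * tnth x j + r' * u) u _ _ (d1 _) da.
      rewrite lin_upd mulrC.
      rewrite (_ : (fun u => _) = (fun u : R => f (upd (lin r x r' z) j u)) \o
        (fun u : R => r * tnth x j + r' * u))//.
      by apply/funext => w; rewrite /= lin_upd.
    + rewrite (_ : (fun u => _) = fun u : R => r' *
        (fun v : R => df (upd (lin r x r' z) j v)) (r * tnth x j + r' * u)); last first.
        by apply/funext => w; rewrite lin_upd.
      move=> u; apply: cvgM; first exact: cvg_cst.
      apply: (@continuous_comp R R R (fun u : R => r * tnth x j + r' * u)
        (fun v : R => df (upd (lin r x r' z) j v)) u); last exact: d2.
      by apply: cvgD; [exact: cvg_cst|apply: cvgM; [exact: cvg_cst|exact: cvg_id]].
rewrite /ou_grad -/r' EFinM -H muleA -EFinM mulVf ?gt_eqF// mul1e.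
by [].
Qed.

(** r X + cosine r Z is again standard Gaussian. *)
Lemma Rintegral_ou_grad n (r : R) (j : 'I_n) (f df : V n -> R) (C : R) :
  0 < r < 1 -> measurable_fun setT f -> measurable_fun setT df ->
  (forall z, 0 <= df z) -> (forall z, `|f z| <= C) -> coord_derivative f j df ->
  \int[gam n]_x ou_grad r j f x = \int[gam n]_x df x.
Proof.
move=> r01 mf mdf df0 fC fdf; have /andP[r0 r1] := r01.
have r11 : -1 < r < 1 by rewrite r1 andbT (lt_trans _ r0)// ltrN10.
have c0 := cosine_gt0 r11.
rewrite /Rintegral; congr fine.
transitivity (\int[gam n]_x \int[gam n]_z (df (lin r x (cosine r) z))%:E)%E.
  apply: eq_integral => x _; apply: esym.
  exact: (ou_gradE x c0 mf mdf df0 fC fdf).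
apply: (@integral_gauss_conv _ n r (cosine r) (EFin \o df)) => //.
- exact: cosineP.
- exact/measurable_EFinP.
Qed.

End stein.

(** * Correlation of monotone functions of tuples *)

(** The primitive of the linear ramp that starts at c and reaches 0 at 1 / k. *)
Lemma is_derive_ramp {R : realType} (c k a : R) : 0 <= c -> 0 < k ->
  is_derive a 1 (fun x : R => - (c / (2 * k)) * Num.max 0 (1 - k * x) ^+ 2)
    (c * Num.max 0 (1 - k * a)).
Proof.
move=> c0 k0; apply: (@is_derive_quadratic _ _ _ _ (c * k / 2) 1) => // h _.
have K (x y : R) : `|Num.max 0 (x + y) ^+ 2 - Num.max 0 x ^+ 2 -
    2 * y * Num.max 0 x| <= y ^+ 2.
  rewrite ler_norml.
  have [xy0|xy0] := lerP 0 (x + y); have [x0|x0] := lerP 0 x;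
    apply/andP; split; nra.
have := K (1 - k * a) (- (k * h)).
have -> : 1 - k * a + - (k * h) = 1 - k * (a + h) by ring.
move: (Num.max 0 (1 - k * (a + h))) (Num.max 0 (1 - k * a)) => p q Kpq.
have -> : - (c / (2 * k)) * p ^+ 2 - - (c / (2 * k)) * q ^+ 2 - h * (c * q) =
   - (c / (2 * k)) * (p ^+ 2 - q ^+ 2 - 2 * - (k * h) * q).
  by field; rewrite gt_eqF.
have c1 : 0 <= c / (2 * k) by rewrite divr_ge0// mulr_ge0// ltW.
rewrite normrM normrN (ger0_norm c1).
rewrite (le_trans (ler_wpM2l c1 Kpq))// le_eqVlt; apply/orP; left; apply/eqP.
by field; rewrite gt_eqF.
Qed.

Section one_monotone_function.
Context {R : realType}.
Notation V n := (n.-tuple (measurableTypeR R)).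
Notation gam := (@std_gaussian R).
Implicit Types (n : nat).

(** What the proof needs of a function: the derivatives are data, so that
    everything can be phrased on tuples, where integration takes place. *)
Record monotone_C1 n (f : V n -> R) (df : 'I_n -> V n -> R) : Prop := {
  mC1_measurable : measurable_fun setT f;
  mC1_bounded : forall z, `|f z| <= 1;
  mC1_dmeasurable : forall j, measurable_fun setT (df j);
  mC1_dge0 : forall j z, 0 <= df j z;
  mC1_derivative : forall j, coord_derivative f j (df j)
}.

Section shifted_function.
Variables (n : nat) (f : V n -> R) (df : 'I_n -> V n -> R).
Hypothesis mf : monotone_C1 f df.
Let F z := f z + 1.

Let F01 z : 0 <= F z <= 2.
Proof.
have := mC1_bounded mf z; rewrite ler_norml /F => /andP[h1 h2].
by apply/andP; split; lra.
Qed.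

Let mF : measurable_fun setT F.
Proof. by apply: measurable_funD => //; exact: mC1_measurable mf. Qed.

Let FB z : `|F z| <= 2.
Proof. by have /andP[h1 h2] := F01 z; rewrite ger0_norm. Qed.

Let dF j : coord_derivative F j (df j).
Proof.
move=> z; have [d1 d2] := mC1_derivative mf j z; split => // u.
have := d1 u => d1u; rewrite /F.
by apply: is_derive_eq; rewrite addr0.
Qed.

Lemma ou_grad_shift (r : R) j x : 0 < cosine r ->
  ou_grad r j F x = ou_grad r j f x.
Proof.
move=> c0; apply: EFin_inj.
rewrite -(ou_gradE x c0 mF (mC1_dmeasurable mf j) (mC1_dge0 mf j) FB (dF j)).
exact: (ou_gradE x c0 (mC1_measurable mf) (mC1_dmeasurable mf j)
  (mC1_dge0 mf j) (mC1_bounded mf) (mC1_derivative mf j)).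
Qed.

Lemma ou_grad_ge0 (r : R) j x : 0 < cosine r -> 0 <= ou_grad r j F x.
Proof.
move=> c0; rewrite -lee_fin.
rewrite -(ou_gradE x c0 mF (mC1_dmeasurable mf j) (mC1_dge0 mf j) FB (dF j)).
by apply: integral_ge0 => z _; rewrite lee_fin (mC1_dge0 mf).
Qed.

Lemma bmeas_mC1 : bmeas f.
Proof. by split; [exact: mC1_measurable mf|exists 1; exact: mC1_bounded mf]. Qed.

Lemma bmeas_mC1_shift : bmeas F.
Proof. by split => //; exists 2. Qed.

(** The shift by 1 does not change the averaged gradient, and |f| <= 1 bounds it
    by (cosine r)^-1 = sqrt 2. *)
Lemma ou_grad_half_le2 j x : ou_grad rhalf j F x <= 2.
Proof.
have r0 : 0 < rhalf :> R by case/andP: (rhalf_itv (R := R)).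
rewrite ou_grad_shift ?cosine_rhalf//.
rewrite (le_trans (ler_norm _))//.
rewrite (le_trans (normr_ou_grad_le _ _ _ bmeas_mC1 (mC1_bounded mf)))//.
rewrite cosine_rhalf mulr1 -(@ler_pXn2r _ 2)// ?nnegrE ?invr_ge0 ?(ltW r0)//.
by rewrite exprVn sqr_rhalf; lra.
Qed.

Lemma mean_ou_grad (r : R) j : 0 < r < 1 ->
  \int[gam n]_x ou_grad r j F x = \int[gam n]_x df j x.
Proof.
move=> r01; exact: (Rintegral_ou_grad r01 mF (mC1_dmeasurable mf j)
  (mC1_dge0 mf j) FB (dF j)).
Qed.

(** By Stein's formula the mean derivative is E [f(X) X_j], with |f| <= 1 and
    E |X_j| <= 1. *)
Lemma mean_df_itv j : 0 <= \int[gam n]_x df j x <= 1.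
Proof.
apply/andP; split; first by apply: Rintegral_ge0 => z _; exact: mC1_dge0 mf _ _.
rewrite {1}/Rintegral (gauss_stein (mC1_measurable mf) (mC1_dmeasurable mf j)
  (mC1_dge0 mf j) (mC1_bounded mf) (mC1_derivative mf j)) /=.
rewrite (le_trans (ler_norm _))//.
exact: (Rintegral_gauss_coord_le _ bmeas_mC1 (mC1_bounded mf)).
Qed.

End shifted_function.

End one_monotone_function.

Section two_monotone_functions.
Context {R : realType}.
Notation V n := (n.-tuple (measurableTypeR R)).
Notation gam := (@std_gaussian R).
Variables (n : nat) (f g : V n -> R) (df dg : 'I_n -> V n -> R).
Hypotheses (mf : monotone_C1 f df) (mg : monotone_C1 g dg).
Let F z := f z + 1.
Let G z := g z + 1.
Let a j := \int[gam n]_x df j x.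
Let b j := \int[gam n]_x dg j x.

Let bF : bmeas F := bmeas_mC1_shift mf.
Let bG : bmeas G := bmeas_mC1_shift mg.

Let F0 z : 0 <= F z.
Proof. by have := mC1_bounded mf z; rewrite ler_norml /F => /andP[h1 _]; lra. Qed.

Let G0 z : 0 <= G z.
Proof. by have := mC1_bounded mg z; rewrite ler_norml /G => /andP[h1 _]; lra. Qed.

Lemma corr_grad_ge0 (r s : R) j : 0 < cosine r ->
  0 <= corr (ou_grad r j F) (ou_grad r j G) s.
Proof.
move=> c0; apply: Rintegral_ge0 => x _; apply: Rintegral_ge0 => y _.
by rewrite mulr_ge0 ?(ou_grad_ge0 mf)// (ou_grad_ge0 mg).
Qed.

(** The derivative is a correlation of nonnegative functions. A level t in
    [0, 1) has to be written r^2 s with both factors below 1; the choice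
    r^2 = (1 + t) / 2, s = 2 t / (1 + t) covers the whole interval. *)
Lemma corr_nondecreasing (x y : R) : 0 <= x -> x <= y -> y < 1 ->
  corr F G x <= corr F G y.
Proof.
move=> x0 xy y1.
pose r (t : R) := Num.sqrt ((1 + t) / 2); pose s (t : R) := 2 * t / (1 + t).
have bnd t : x <= t <= y -> 0 <= t < 1.
  by move=> /andP[xt ty]; apply/andP; split; lra.
have r2 t : 0 <= t < 1 -> r t ^+ 2 = (1 + t) / 2.
  by move=> /andP[t0 t1]; rewrite sqr_sqrtr//; lra.
have r01 t : 0 <= t < 1 -> 0 < r t < 1.
  move=> t01; have /andP[t0 t1] := t01.
  have r0 : 0 < r t by rewrite sqrtr_gt0; lra.
  by rewrite r0; have := r2 t t01; nra.
apply: (@is_derive_ge0_le _ (corr F G) (fun t => \sum_(j < n)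
    corr (ou_grad (r t) j F) (ou_grad (r t) j G) (s t))) => // t /bnd t01.
- have /andP[t0 t1] := t01.
  have s1 : -1 < s t < 1.
    apply/andP; split; rewrite /s; last by rewrite ltr_pdivrMr; lra.
    by rewrite (@lt_le_trans _ _ 0)// divr_ge0; lra.
  have := is_derive_corr (r01 t t01) s1 bF bG F0 G0.
  rewrite r2// (_ : (1 + t) / 2 * s t = t)// /s; field.
  by rewrite gt_eqF//; lra.
- apply: sumr_ge0 => j _; apply: corr_grad_ge0; apply: cosine_gt0.
  have /andP[r0 r1] := r01 t t01; rewrite r1 andbT.
  by rewrite (lt_trans _ r0)// ltrN10.
Qed.

(** By [is_derive_corr] with r^2 = 1/2, the derivative of the correlation at x
    is the sum over j of correlations at level 2 x of the averaged gradients,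
    each at least a_j b_j (1 - 16 S_j x) by [corr_lower_bound], and
    nonnegative. So it dominates a sum of ramps, of area a_j b_j / (32 S_j).
    Since S_j >= 1 each ramp vanishes at 3/8, an endpoint below the bound 1/2
    that r^2 = 1/2 allows. *)
Lemma corr_increment :
  1 / 32 * \sum_(j < n) talagrand_term (a j) (b j) <=
  corr F G (3 / 8) - corr F G 0.
Proof.
have sub4 (p q r s : R) : p - q <= r - s -> s - q <= r - p by lra.
pose S j := Num.sqrt (logterm (a j) * logterm (b j)).
pose nz j := (0 < a j) && (0 < b j).
pose c j := if nz j then a j * b j else 0.
pose k j := if nz j then 16 * S j else 16.
have a01 j : 0 <= a j <= 1 := mean_df_itv mf j.
have b01 j : 0 <= b j <= 1 := mean_df_itv mg j.
have S1 j : nz j -> 1 <= S j.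
  move=> /andP[aj bj]; have /andP[_ aj1] := a01 j; have /andP[_ bj1] := b01 j.
  have La : 1 <= logterm (a j) by apply: logterm_ge1; rewrite aj.
  have Lb : 1 <= logterm (b j) by apply: logterm_ge1; rewrite bj.
  by rewrite -sqrtr1 ler_wsqrtr// (le_trans La)// ler_peMr// (le_trans _ La).
have k16 j : 16 <= k j.
  by rewrite /k; case: ifP => // /S1 h; lra.
have c0 j : 0 <= c j.
  by rewrite /c; case: ifP => // /andP[aj bj]; rewrite mulr_ge0// ltW.
have k0 j : 0 < k j by have := k16 j; lra.
pose h j (x : R) := - (c j / (2 * k j)) * Num.max 0 (1 - k j * x) ^+ 2.
pose dN x := \sum_(j < n) corr (ou_grad rhalf j F) (ou_grad rhalf j G) (2 * x).
have cr : 0 < cosine rhalf :> R.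
  by rewrite cosine_rhalf; case/andP: (rhalf_itv (R := R)).
have key j x : 0 <= x <= 3 / 8 -> c j * Num.max 0 (1 - k j * x) <=
    corr (ou_grad rhalf j F) (ou_grad rhalf j G) (2 * x).
  move=> /andP[x0 x38].
  have ge0 := corr_grad_ge0 (2 * x) j cr.
  rewrite /c /k; case: ifP => [nzj|_]; last by rewrite mul0r.
  have [kx|kx] := lerP (1 - 16 * S j * x) 0.
    by rewrite mulr0.
  have Sj := S1 j nzj.
  have x14 : 2 * x < 1 / 2.
    rewrite ltNge; apply/negP => x14; move: kx; apply/negP; rewrite -leNgt.
    by nra.
  have /andP[aj bj] := nzj.
  have /andP[_ aj1] := a01 j; have /andP[_ bj1] := b01 j.
  have u2 x' : 0 <= ou_grad rhalf j F x' <= 2.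
    by rewrite (ou_grad_ge0 mf)//= (ou_grad_half_le2 mf).
  have v2 x' : 0 <= ou_grad rhalf j G x' <= 2.
    by rewrite (ou_grad_ge0 mg)//= (ou_grad_half_le2 mg).
  have := @corr_lower_bound R n (ou_grad rhalf j F) (ou_grad rhalf j G) (2 * x)
    (bmeas_ou_grad _ _ bF) (bmeas_ou_grad _ _ bG) u2 v2.
  cbv zeta; rewrite (mean_ou_grad mf j (rhalf_itv (R := R))).
  rewrite (mean_ou_grad mg j (rhalf_itv (R := R))) -/(a j) -/(b j) -/(S j).
  rewrite aj aj1 bj bj1 x14 mulr_ge0// => /(_ isT isT isT).
  by rewrite (_ : 2 * (4 * S j) * (2 * x) = 16 * S j * x)//; ring.
have dNE (x : R) : 0 <= x <= 3 / 8 -> is_derive x 1 (corr F G) (dN x).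
  move=> /andP[x0 x38].
  have x1 : -1 < 2 * x < 1 by apply/andP; split; lra.
  have := is_derive_corr (rhalf_itv (R := R)) x1 bF bG F0 G0.
  by rewrite sqr_rhalf (_ : 1 / 2 * (2 * x) = x)//; field.
pose D x := corr F G x - \sum_(j < n) h j x.
have dhE (x : R) : is_derive x 1 (fun x => \sum_(j < n) h j x)
    (\sum_(j < n) c j * Num.max 0 (1 - k j * x)).
  rewrite (_ : (fun x => _) = \sum_(j < n) h j); last first.
    by apply/funext => y; rewrite fct_sumE.
  by apply: is_derive_sum => j; exact: is_derive_ramp.
have D38 : D 0 <= D (3 / 8).
  apply: (@is_derive_ge0_le _ D
    (fun x => dN x - \sum_(j < n) c j * Num.max 0 (1 - k j * x))).
  - lra.
  - move=> x xb; have d1 := dNE x xb; have d2 := dhE x.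
    by apply: is_deriveB.
  - by move=> x xb; rewrite subr_ge0; apply: ler_sum => j _; exact: key.
apply: (@le_trans _ _ (\sum_(j < n) h j (3 / 8) - \sum_(j < n) h j 0)); last first.
  exact: sub4 D38.
rewrite -sumrB mulr_sumr; apply: ler_sum => j _.
rewrite /h mulr0 subr0.
have -> : Num.max 0 (1 - k j * (3 / 8)) = 0.
  by apply/max_idPl; have := k16 j; lra.
have -> : Num.max 0 1 = 1 :> R by apply/max_idPr.
rewrite expr0n/= mulr0 expr1n mulr1 opprK add0r.
rewrite /talagrand_term /c /k /nz.
have /andP[aj0 _] := a01 j; have /andP[bj0 _] := b01 j.
have [->|an0] := eqVneq (a j) 0; first by rewrite ltxx/= mulr0 mul0r.
have [->|bn0] := eqVneq (b j) 0; first by rewrite ltxx andbF/= mulr0 mul0r.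
have aj : 0 < a j by rewrite lt_neqAle eq_sym an0.
have bj : 0 < b j by rewrite lt_neqAle eq_sym bn0.
rewrite aj bj /= -/(logterm (a j)) -/(logterm (b j)) -/(S j).
have Sj : 1 <= S j by apply: S1; rewrite /nz aj bj.
rewrite le_eqVlt; apply/orP; left; apply/eqP; field.
by rewrite gt_eqF//; lra.
Qed.

End two_monotone_functions.

Section corr_limit.
Context {R : realType}.
Notation V n := (n.-tuple (measurableTypeR R)).
Notation gam := (@std_gaussian R).
Implicit Types (n : nat).

Lemma Rintegral_prod_iter d (S : measurableType d) d' (T : measurableType d')
    (P : probability S R) (Q : probability T R) (h : S * T -> R) :
  bmeas h -> (forall p, 0 <= h p) ->
  \int[(P \x Q)%E]_p h p = \int[P]_x \int[Q]_y h (x, y).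
Proof.
move=> bh h0; apply: EFin_inj; rewrite -Rintegral_iter2//.
rewrite -EFin_Rintegral; last exact: (bmeas_integrable (P \x Q)%E bh).
rewrite fubini_tonelli1//; first by apply/measurable_EFinP; case: bh.
Qed.

(** N(rho) tends to E [f g] as rho tends to 1. The limit is taken along
    rho = cosine s with s tending to 0, where the second function is evaluated
    at cosine s x + s y, which depends continuously on s. *)
Lemma corr_lt_diag n (f g : V n -> R) (c : R) : bmeas f -> bmeas g ->
  (forall x, 0 <= f x) -> (forall x, 0 <= g x) ->
  (forall x y, {in `](-1), 1[, continuous (fun s : R => g (lin (cosine s) x s y))}) ->
  \int[gam n]_x (f x * g x) < c ->
  exists2 rho, 1 / 2 < rho < 1 & corr f g rho < c.
Proof.
move=> bf bg f0 g0 cg fgc.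
pose P : probability (V n * V n)%type R := (gam n \x gam n)%E.
pose h (s : R) (p : V n * V n) := f p.1 * g (lin (cosine s) p.1 s p.2).
pose psi s := \int[P]_p h s p.
have bh s : bmeas (h s).
  apply: bmeasM; first exact: bmeas_comp bf.
  by apply: bmeas_comp bg; exact: measurable_lin.
have psiE s : psi s = \int[gam n]_x \int[gam n]_y (f x * g (lin (cosine s) x s y)).
  by apply: (Rintegral_prod_iter _ _ (bh s)) => p; rewrite mulr_ge0.
have [_ [Cf hf]] := bf; have [_ [Cg hg]] := bg.
have cpsi : {in (`](-1), 1[%classic : set R), continuous psi}.
  apply: (@continuity_under_integral R _ _ P h setT measurableT (-1) 1 _ _
    (cst (Cf * Cg))).
  - by move=> s _; exact: bmeas_integrable.
  - apply: aeW => p _ s s1; apply: cvgM; first exact: cvg_cst.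
    by apply: cg; move: s1; rewrite inE.
  - exact: (bmeas_integrable P (bmeas_cst _ _)).
  - by move=> s _; apply: aeW => p _; rewrite normrM ler_pM.
have c0 : cosine (0 : R) = 1 by rewrite /cosine expr0n subr0 sqrtr1.
have psi0 : psi 0 = \int[gam n]_x (f x * g x).
  rewrite psiE; apply: eq_Rintegral => x _.
  transitivity (\int[gam n]_y (f x * g x)); last exact: Rintegral_cst_prob.
  apply: eq_Rintegral => y _; congr (_ * g _).
  by apply: eq_from_tnth => i; rewrite tnth_mktuple c0 mul1r mul0r addr0.
have cp : psi s @[s --> (0 : R)] --> psi 0.
  by apply: cpsi; rewrite inE/= in_itv/= ltrN10 ltr01.
have nr : \forall s \near (0 : R), psi s < c.
  by apply: (cvgr_lt (psi 0) cp); rewrite psi0.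
have [e /= e0 He] := nr.
(* The bound 1/2 on s makes cosine s larger than 1/2. *)
pose s := Num.min (e / 2) (1 / 2).
have s0 : 0 < s by rewrite lt_min divr_gt0//=; lra.
have s1 : s <= 1 / 2 by rewrite ge_min lexx orbT.
have se : s < e by rewrite gt_min ltr_pdivrMr// mulr_natr mulr2n ltrDl e0.
have psis : psi s < c.
  by apply: He; rewrite /ball /= sub0r normrN gtr0_norm.
have s2 : s ^+ 2 <= 1 / 4 by nra.
have s20 : 0 < s ^+ 2 by rewrite exprn_gt0.
exists (cosine s).
  have c2 : cosine s ^+ 2 = 1 - s ^+ 2 by rewrite sqr_sqrtr//; lra.
  have cg0 : 0 <= cosine s := sqrtr_ge0 _.
  by apply/andP; split; nra.
have -> : corr f g (cosine s) = psi s; last exact: psis.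
rewrite psiE; apply: eq_Rintegral => x _; apply: eq_Rintegral => y _.
congr (_ * g (lin _ _ _ _)).
rewrite /cosine sqr_sqrtr; last by lra.
by rewrite opprB addrC subrK sqrtr_sqr ger0_norm// ltW.
Qed.

(** The covariance is that of F = f + 1 and G = g + 1. If E [F G] were below
    N(3/8), some N(rho) with rho > 3/8 would be too, against monotonicity. *)
Theorem tuple_correlation n (f g : V n -> R) (df dg : 'I_n -> V n -> R) :
  monotone_C1 f df -> monotone_C1 g dg ->
  (forall x y, {in `](-1), 1[, continuous (fun s : R => g (lin (cosine s) x s y))}) ->
  1 / 32 * \sum_(j < n) talagrand_term (\int[gam n]_x df j x) (\int[gam n]_x dg j x)
    <= \int[gam n]_x (f x * g x) - \int[gam n]_x f x * \int[gam n]_x g x.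
Proof.
have h38 : 0 <= 3 / 8 :> R by lra.
have num (x : R) : 1 / 2 < x -> 3 / 8 <= x by lra.
move=> mf mg cg; apply: le_trans (corr_increment mf mg) _.
have bf := bmeas_mC1 mf; have bg := bmeas_mC1 mg.
have bF := bmeas_mC1_shift mf; have bG := bmeas_mC1_shift mg.
set F := fun z => f z + 1 in bF *; set G := fun z => g z + 1 in bG *.
have F0 z : 0 <= F z.
  by have := mC1_bounded mf z; rewrite ler_norml /F => /andP[h1 _]; lra.
have G0 z : 0 <= G z.
  by have := mC1_bounded mg z; rewrite ler_norml /G => /andP[h1 _]; lra.
have cG x y : {in `](-1), 1[, continuous (fun s : R => G (lin (cosine s) x s y))}.
  by move=> s s1; apply: cvgD; [exact: cg|exact: cvg_cst].
have ->: \int[gam n]_x (f x * g x) - \int[gam n]_x f x * \int[gam n]_x g x =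
    \int[gam n]_x (F x * G x) - corr F G 0.
  rewrite corr0//.
  have -> : (fun x => F x * G x) = fun x => f x * g x + (f x + G x).
    by apply/funext => x; rewrite /F /G; ring.
  have bfg := bmeasM bf bg.
  rewrite (RintegralD_bmeas (gam n) bfg (bmeasD bf bG)).
  rewrite (RintegralD_bmeas (gam n) bf bG).
  rewrite (RintegralD_bmeas (gam n) bf (bmeas_cst _ 1)).
  rewrite (RintegralD_bmeas (gam n) bg (bmeas_cst _ 1)) !Rintegral_cst_prob.
  by ring.
rewrite lerD2r leNgt; apply/negP => lt.
have [rho /andP[r1 r2] lt'] := corr_lt_diag bF bG F0 G0 cG lt.
have : corr F G (3 / 8) <= corr F G rho.
  exact: (corr_nondecreasing mf mg h38 (num _ r1) r2).
by rewrite leNgt lt'.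
Qed.

End corr_limit.

(** * Functions of row vectors *)

Section row_vectors.
Context {R : realType}.
Notation V n := (n.-tuple (measurableTypeR R)).
Implicit Types (n : nat).

Definition row_of n (t : V n) : 'rV[R]_n := \row_i (tnth t i : R).

(** Half-open boxes of rational grids, indexed by a countable type. *)
Definition cell n (p : nat * n.-tuple int) : set (V n) :=
  [set t | forall i, `[(tnth p.2 i)%:~R / p.1.+1%:R,
                       (tnth p.2 i + 1)%:~R / p.1.+1%:R[%classic (tnth t i)].

Lemma measurable_cell n (p : nat * n.-tuple int) : measurable (cell p).
Proof.
apply: (measurable_box (A := fun i => `[(tnth p.2 i)%:~R / p.1.+1%:R : R,
  (tnth p.2 i + 1)%:~R / p.1.+1%:R[%classic)) => i.
exact: measurable_itv.
Qed.

(** The sigma-algebra of tuples is generated by the coordinates; it contains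
    the open sets because each is a countable union of grid boxes. *)
Lemma measurable_row_preimage n (U : set 'rV[R]_n) : open U ->
  measurable (@row_of n @^-1` U).
Proof.
move=> oU.
have close (z d x y : R) : z <= x -> x < z + d -> z <= y -> y < z + d ->
    `|x - y| < d.
  by move=> *; rewrite ltr_norml; apply/andP; split; lra.
rewrite (_ : _ @^-1` U =
  \bigcup_(p in [set p | @cell n p `<=` @row_of n @^-1` U]) cell p); last first.
  apply/seteqP; split => [t Ut|t [p /= pU pt]]; last exact: pU.
  move: oU; rewrite openE => /(_ _ Ut) /nbhs_ballP[e /= e0 eU].
  (* A mesh finer than e keeps the box around t inside the ball. *)
  pose k := Num.trunc e^-1.
  have ke : k.+1%:R^-1 < e.
    rewrite invf_plt ?posrE//; exact: truncnS_gt.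
  pose q := [tuple Num.floor (tnth t i * k.+1%:R) | i < n].
  have k0 : 0 < k.+1%:R :> R by rewrite ltr0n.
  have cellP (s : V n) i : cell (k, q) s ->
      (Num.floor (tnth t i * k.+1%:R))%:~R / k.+1%:R <= tnth s i <
      (Num.floor (tnth t i * k.+1%:R) + 1)%:~R / k.+1%:R.
    by move=> /(_ i) /=; rewrite in_itv/= tnth_mktuple.
  have tq : cell (k, q) t.
    move=> i /=; rewrite in_itv/= tnth_mktuple ler_pdivrMr// ltr_pdivlMr//.
    by rewrite ge_floor floorD1_gt.
  exists (k, q) => //= s sq; apply: eU; split => // i0 i.
  rewrite /ball /= !mxE.
  have /andP[t1 t2] := cellP t i tq; have /andP[s1 s2] := cellP s i sq.
  move: t1 t2 s1 s2; rewrite intrD mulrDl mul1r => t1 t2 s1 s2.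
  by apply: lt_trans ke; exact: (close _ _ _ _ t1 t2 s1 s2).
rewrite bigcup_mkcond; apply: countable_bigcupT_measurable => // p.
by case: ifP => // _; exact: measurable_cell.
Qed.

Lemma measurable_row_continuous n (h : 'rV[R]_n -> R) : continuous h ->
  measurable_fun setT (fun t : V n => h (row_of t)).
Proof.
move=> ch; apply: (measurability _ (RGenOpens.measurableE R)).
move=> _ [_ [a [b ->] <-]]; rewrite setTI.
apply: (@measurable_row_preimage n (h @^-1` `]a, b[)).
by move/continuousP : ch; apply; exact: interval_open.
Qed.


Lemma row_of_lin n (a b : R) (x y : V n) :
  row_of (lin a x b y) = a *: row_of x + b *: row_of y.
Proof. by apply/rowP => i; rewrite !mxE tnth_mktuple. Qed.

Lemma row_of_upd n (z : V n) (j : 'I_n) (u h : R) :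
  row_of (upd z j (h + u)) = h *: delta_mx 0 j + row_of (upd z j u).
Proof.
apply/rowP => i; rewrite !mxE !tnth_mktuple /=.
by have [_|_] := eqVneq i j; rewrite /= ?mulr1 ?mulr0 ?add0r.
Qed.

Lemma is_derive_row n (f : 'rV[R]_n -> R) (j : 'I_n) (z : V n) (u : R) :
  differentiable f (row_of (upd z j u)) ->
  is_derive u 1 (fun u : R => f (row_of (upd z j u)))
    (partial j f (row_of (upd z j u))).
Proof.
move=> df.
have E : (fun h : R => h^-1 *: (((fun u : R => f (row_of (upd z j u))) \o shift u)
      (h *: (1 : R)) - f (row_of (upd z j u)))) =
    (fun h : R => h^-1 *: ((f \o shift (row_of (upd z j u))) (h *: delta_mx 0 j)
      - f (row_of (upd z j u)))).
  by apply/funext => h /=; rewrite -row_of_upd [h *: 1]mulr1.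
have dv : derivable f (row_of (upd z j u)) (delta_mx 0 j).
  exact: diff_derivable.
apply: DeriveDef; first by rewrite /derivable E.
by rewrite /partial /derive E.
Qed.

Lemma partial_ge0 n (f : 'rV[R]_n -> R) (j : 'I_n) x :
  differentiable f x -> increasing f -> 0 <= partial j f x.
Proof.
move=> df incf; apply: limr_ge; first exact: diff_derivable.
near=> h; rewrite /GRing.scale /=.
have [h0|h0] := lerP 0 h.
  by rewrite mulr_ge0 ?invr_ge0// subr_ge0 addrC incf.
rewrite mulr_le0// ?invr_le0 ?(ltW h0)// subr_le0.
have := incf j (h *: delta_mx 0 j + x) (- h).
by rewrite scaleNr addrAC subrr add0r oppr_ge0 ltW// => ->.
Unshelve. all: by end_near. Qed.

Lemma continuous_row_upd n (j : 'I_n) (z : V n) :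
  continuous (fun u : R => row_of (upd z j u)).
Proof.
have -> : (fun u : R => row_of (upd z j u)) =
    (fun u : R => u *: delta_mx 0 j + row_of (upd z j 0)).
  by apply/funext => u; rewrite -row_of_upd addr0.
move=> u; apply: cvgD; last exact: cvg_cst.
by apply: cvgZ; [exact: cvg_id|exact: cvg_cst].
Qed.

Lemma continuous_row_lin n (x y : V n) :
  continuous (fun s : R => row_of (lin (cosine s) x s y)).
Proof.
rewrite (_ : (fun s => _) =
    (fun s : R => cosine s *: row_of x + s *: row_of y)); last first.
  by apply/funext => s; rewrite row_of_lin.
move=> s; apply: cvgD; apply: cvgZ; try exact: cvg_cst; last exact: cvg_id.
apply: (@continuous_comp _ _ _ (fun s : R => 1 - s ^+ 2) Num.sqrt).
  by apply: cvgB; [exact: cvg_cst|exact: exprn_continuous].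
exact: sqrt_continuous.
Qed.

Lemma monotone_C1_row n (f : 'rV[R]_n -> R) :
  (forall x, -1 <= f x <= 1) -> increasing f -> continuously_differentiable f ->
  monotone_C1 (fun t : V n => f (row_of t)) (fun j t => partial j f (row_of t)).
Proof.
move=> f1 incf [df cdf].
have cf : continuous f by move=> x; exact: differentiable_continuous.
split.
- exact: measurable_row_continuous.
- by move=> z; rewrite ler_norml f1.
- by move=> j; apply: measurable_row_continuous; exact: cdf.
- by move=> j z; exact: partial_ge0.
- move=> j z; split; first by move=> u; exact: is_derive_row.
  move=> u; apply: (@continuous_comp _ _ _ (fun u : R => row_of (upd z j u)) (partial j f)).
    exact: continuous_row_upd.
  exact: cdf.
Qed.

End row_vectors.

Theorem theorem3p1 (R : realType) :
  exists c : R, 0 < c /\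
  forall (n : nat) (f g : 'rV[R]_n -> R),
    (1 <= n)%N ->
    (forall x, -1 <= f x <= 1) -> (forall x, -1 <= g x <= 1) ->
    increasing f -> increasing g ->
    continuously_differentiable f -> continuously_differentiable g ->
    c * \sum_(i < n) talagrand_term (gaussE (partial i f)) (gaussE (partial i g))
      <= gaussE (fun x => f x * g x) - gaussE f * gaussE g.
Proof.
exists (1 / 32); split; first lra.
move=> n f g _ f1 g1 incf incg Cf Cg.
apply: (tuple_correlation (monotone_C1_row f1 incf Cf) (monotone_C1_row g1 incg Cg)).
move=> x y s _.
apply: (@continuous_comp _ _ _ (fun s : R => row_of (lin (cosine s) x s y)) g).
  exact: continuous_row_lin.
by apply: differentiable_continuous; case: Cg.
Qed.
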